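(* Let $d\ge1$ be an integer and let $X_1,X_2$ be $\mathbb{R}^d$-valued random variables with characteristic functions $\phi_1,\phi_2$ such that, for some $r,C_r>0$, $$E[e^{r|X_i|}]\le C_r,\qquad \int_{\mathbb{R}^d}|\phi_i(u)|e^{r|u|}\,du\le C_r,\quad i=1,2.$$ Then there are constants $G,G'$, depending only on $d,r,C_r$, such that $$d_{TV}(X_1,X_2)\le G\,d_{FM}(X_1,X_2)\,|\ln d_{FM}(X_1,X_2)|^{2d+1}$$ and $$\sup_{x\in\mathbb{R}^d}|f_1(x)-f_2(x)|\le G'\,d_{FM}(X_1,X_2)\,|\ln d_{FM}(X_1,X_2)|^{d+1},$$ where $f_1,f_2$ are the density functions of $X_1,X_2$.
   Context: $|\cdot|$ is the Euclidean norm (absolute value for scalars), and $\phi_j(u)=E[e^{i\langle u,X_j\rangle}]$, $j=1,2$, with $i$ in the exponent the imaginary unit. Since $\phi_1,\phi_2$ are integrable, $X_1,X_2$ have densities $f_1,f_2$ with respect to $d$-dimensional Lebesgue measure, given by the inverse Fourier transforms of $\phi_1,\phi_2$. The Fortet-Mourier distance is $d_{FM}(X_1,X_2)=\sup_{f\in\mathcal{M}_1}|E[f(X_1)]-E[f(X_2)]|$, where $\mathcal{M}_1$ is the set of continuously differentiable $f:\mathbb{R}^d\to\mathbb{R}$ with $\|f\|_\infty+\|\nabla f\|_\infty\le1$ ($\|\cdot\|_\infty$ being the supremum over $\mathbb{R}^d$ of the Euclidean norm). The total variation distance is $d_{TV}(X_1,X_2)=\sup_{|f|\le1}|E[f(X_1)]-E[f(X_2)]|$,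 over measurable $f:\mathbb{R}^d\to\mathbb{R}$ with $|f|\le1$.
   Formalization: As stated the bounds fail when d_FM(X_1,X_2) equals or is near 1, where the logarithm vanishes; the formal theorem assumes |d_FM(X_1,X_2) - 1| >= delta for an arbitrary fixed delta > 0, and G, G' depend on delta as well as d, r, C_r. *)

(* Defs.v *)
From HB Require Import structures.
From mathcomp Require Import all_boot all_order all_algebra.
From mathcomp Require Import complex.
From mathcomp Require Import all_classical all_reals all_analysis.

Set Implicit Arguments.
Unset Strict Implicit.
Unset Printing Implicit Defensive.

Import Order.TTheory GRing.Theory Num.Theory.
Import numFieldNormedType.Exports.

Local Open Scope classical_set_scope.
Local Open Scope ring_scope.

(* R^d is the type 'rV[R]_d with the topology of mathcomp-analysis. Its
   sigma-algebra is the product one, generated by the coordinates, as the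
   library does for n.-tuple; for R^d this is the Borel sigma-algebra. *)
Definition measure_row_display : measure_display -> measure_display.
Proof. exact. Qed.

Section measurable_row.
Context {disp} {T : sigmaRingType disp}.
Variable n : nat.

Let coors : 'I_n -> 'rV[T]_n -> T := fun i x => x ord0 i.

Let row_set0 : g_sigma_preimage coors set0.
Proof. exact: sigma_algebra0. Qed.

Let row_setC A : g_sigma_preimage coors A -> g_sigma_preimage coors (~` A).
Proof. exact: sigma_algebraC. Qed.

Let row_bigcup (F : _^nat) : (forall i, g_sigma_preimage coors (F i)) ->
  g_sigma_preimage coors (\bigcup_i (F i)).
Proof. exact: sigma_algebra_bigcup. Qed.

HB.instance Definition _ := @isMeasurable.Build (measure_row_display disp)
  'rV[T]_n (g_sigma_preimage coors) row_set0 row_setC row_bigcup.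

End measurable_row.

Lemma measurable_coor disp (T : sigmaRingType disp) n (i : 'I_n) :
  measurable_fun [set: 'rV[T]_n] (fun x : 'rV[T]_n => x ord0 i).
Proof.
move=> _ Y mY; rewrite setTI; apply: sub_sigma_algebra => /=.
rewrite -bigcup_seq/=; exists i => /=; first by rewrite mem_index_enum.
by exists Y => //; rewrite setTI.
Qed.

Lemma measurable_fun_coorP d1 d2 (T1 : measurableType d1)
    (T2 : measurableType d2) n (f : T1 -> 'rV[T2]_n) :
  measurable_fun [set: T1] f <->
  forall i, measurable_fun [set: T1] (fun x => f x ord0 i).
Proof.
split=> [mf i|mf].
  exact: (measurableT_comp (@measurable_coor _ T2 n i) mf).
suff H : g_sigma_preimage (fun (i : 'I_n) (x : 'rV[T2]_n) => x ord0 i)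
    `<=` [set A | measurable (f @^-1` A)].
  by move=> _ A mA; rewrite setTI; exact: H.
apply: smallest_sub.
  split=> /=.
  - by rewrite preimage_set0; exact: measurable0.
  - by move=> A /= mA; rewrite setTD preimage_setC; exact: measurableC.
  - by move=> F mF /=; rewrite preimage_bigcup; exact: bigcup_measurable.
rewrite -bigcup_seq => A [i /= _ [B mB <-]] /=.
rewrite setTI -[X in measurable X]setTI; exact: mf.
Qed.

Section lebesgue_row.
Context {R : realType}.
Local Open Scope ereal_scope.

Definition row_cons n (p : (measurableTypeR R * 'rV[R]_n)%type) : 'rV[R]_n.+1 :=
  @row_mx R 1 1 n (const_mx p.1) p.2.

Definition row_uncons n (v : 'rV[R]_n.+1) : (measurableTypeR R * 'rV[R]_n)%type :=
  (v ord0 ord0, \row_i v ord0 (lift ord0 i)).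

Lemma row_cons0 n (p : (measurableTypeR R * 'rV[R]_n)%type) : row_cons p ord0 ord0 = p.1.
Proof.
rewrite /row_cons mxE; case: splitP => [j _|k /= /esym/eqP //].
by rewrite mxE.
Qed.

Lemma row_consS n (p : (measurableTypeR R * 'rV[R]_n)%type) i :
  row_cons p ord0 (lift ord0 i) = p.2 ord0 i.
Proof.
rewrite /row_cons mxE; case: splitP => [j|k] /=.
  by rewrite (ord1 j).
by rewrite /bump /= => -[/val_inj ->].
Qed.

Lemma row_consK n : cancel (@row_cons n) (@row_uncons n).
Proof.
move=> p; rewrite /row_uncons row_cons0 [RHS]surjective_pairing; congr (_, _).
by apply/rowP => i; rewrite mxE row_consS.
Qed.

Lemma measurable_row_cons n : measurable_fun setT (@row_cons n).
Proof.
apply/measurable_fun_coorP => i; case: (unliftP ord0 i) => [j ->|->].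
  rewrite (_ : (fun _ => _) = (fun p : (measurableTypeR R * 'rV[R]_n)%type => p.2 ord0 j)).
    exact: (measurableT_comp (@measurable_coor _ R n j) measurable_snd).
  by apply/funext => p; rewrite row_consS.
rewrite (_ : (fun _ => _) = fst); first exact: measurable_fst.
by apply/funext => p; rewrite row_cons0.
Qed.

Lemma measurable_row_uncons n : measurable_fun setT (@row_uncons n).
Proof.
apply: measurable_fun_pair; first exact: measurable_coor.
apply/measurable_fun_coorP => i.
rewrite (_ : (fun _ => _) = (fun v : 'rV[R]_n.+1 => v ord0 (lift ord0 i))).
  exact: measurable_coor.
by apply/funext => v; rewrite mxE.
Qed.

Section row_measure.
Variables (n : nat) (m : {sigma_finite_measure set 'rV[R]_n -> \bar R}).

Definition row_measure : set 'rV[R]_n.+1 -> \bar R :=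
  pushforward (@lebesgue_measure R \x m) (@row_cons n).

Let mcons A : measurable A -> measurable (@row_cons n @^-1` A).
Proof. by move=> mA; rewrite -[X in measurable X]setTI; exact: measurable_row_cons. Qed.

Let row_measure0 : row_measure set0 = 0.
Proof. by rewrite /row_measure /pushforward preimage_set0 measure0. Qed.

Let row_measure_ge0 A : 0 <= row_measure A.
Proof. exact: (measure_ge0 (@lebesgue_measure R \x m)). Qed.

Let row_measure_sigma_additive : semi_sigma_additive row_measure.
Proof.
move=> F mF tF mUF; rewrite /row_measure /pushforward preimage_bigcup.
apply: measure_semi_sigma_additive.
- by move=> k; exact: mcons.
- apply/trivIsetP => /= i j _ _ ij; rewrite -preimage_setI.
  by move/trivIsetP : tF => /(_ _ _ _ _ ij) ->//; rewrite preimage_set0.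
- by rewrite -preimage_bigcup; exact: mcons.
Qed.

HB.instance Definition _ := isMeasure.Build _ _ _ row_measure
  row_measure0 row_measure_ge0 row_measure_sigma_additive.

Let row_measure_sigma_finite : sigma_finite setT row_measure.
Proof.
have /sigma_finiteP[F [TF ndF Foo]] := sigma_finiteT (@lebesgue_measure R).
have /sigma_finiteP[G [TG ndG Goo]] := sigma_finiteT m.
exists (fun k => @row_uncons n @^-1` (F k `*` G k)).
  rewrite -preimage_bigcup (_ : \bigcup_k _ = setT) ?preimage_setT//.
  apply/seteqP; split=> // -[x y] _.
  have [k _ Fkx] : (\bigcup_k F k) x by rewrite -TF.
  have [l _ Gly] : (\bigcup_k G k) y by rewrite -TG.
  exists (maxn k l) => //; split => /=.
    by move: Fkx; exact/subsetPset/ndF/leq_maxl.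
  by move: Gly; exact/subsetPset/ndG/leq_maxr.
move=> k; have [mF Fk] := Foo k; have [mG Gk] := Goo k; split.
  rewrite -[X in measurable X]setTI; apply: measurable_row_uncons => //.
  exact: measurableX.
rewrite /row_measure /pushforward -comp_preimage.
rewrite (_ : _ \o _ = id); last by apply/funext => p; exact: row_consK.
by rewrite preimage_id product_measure1E// lte_mul_pinfty// ge0_fin_numE.
Qed.

HB.instance Definition _ := Measure_isSigmaFinite.Build _ _ _ row_measure
  row_measure_sigma_finite.

End row_measure.

Definition row_dirac : {sigma_finite_measure set 'rV[R]_0 -> \bar R} :=
  @dirac _ 'rV[R]_0 0%R R.

(* Lebesgue measure on R^n: unit mass on the point R^0, then the product with
   the Lebesgue measure of R, transported along R * R^n = R^(n+1). *)
Fixpoint lebesgue_row n : {sigma_finite_measure set 'rV[R]_n -> \bar R} :=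
  match n with
  | 0 => row_dirac
  | k.+1 => row_measure (lebesgue_row k)
  end.

(* It is the measure that gives each box the product of its side lengths. *)
Lemma lebesgue_row_box n (a b : 'I_n -> R) : (forall i, a i <= b i)%R ->
  lebesgue_row n [set x | forall i, (a i <= x ord0 i <= b i)%R] =
  (\prod_(i < n) (b i - a i))%:E.
Proof.
elim: n a b => [|n IH] a b ab.
  by rewrite big_ord0 /= diracE mem_set// => -[].
rewrite big_ord_recl EFinM -IH; last by move=> i; exact: ab.
rewrite /= /row_measure /pushforward.
pose B := [set x : 'rV[R]_n |
  forall i, (a (lift ord0 i) <= x ord0 i <= b (lift ord0 i))%R].
have consE : @row_cons n @^-1` [set x | forall i, (a i <= x ord0 i <= b i)%R] =
    (`[a ord0, b ord0]%classic : set (measurableTypeR R)) `*` B.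
  apply/seteqP; split=> -[x v] /=.
    move=> H; split; first by have := H ord0; rewrite row_cons0 /= in_itv.
    by move=> i; have := H (lift ord0 i); rewrite row_consS.
  rewrite in_itv /= => -[H1 H2] i; case: (unliftP ord0 i) => [j ->|->].
    by rewrite row_consS; exact: H2.
  by rewrite row_cons0.
have mB : measurable B.
  rewrite (_ : B = \bigcap_(i in [set: 'I_n]) (fun x : 'rV[R]_n => x ord0 i) @^-1`
      `[a (lift ord0 i), b (lift ord0 i)]%classic).
    apply: fin_bigcap_measurable => // i _.
    by rewrite -[X in measurable X]setTI; exact: measurable_coor.
  apply/seteqP; split=> x /= H i; first by move=> _; rewrite /= in_itv; exact: H.
  by move: (H i Logic.I); rewrite /= ?in_itv.
transitivity ((@lebesgue_measure R \x lebesgue_row n)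
    ((`[a ord0, b ord0]%classic : set (measurableTypeR R)) `*` B)).
  by rewrite -consE.
rewrite product_measure1E//; congr (_ * _).
apply: etrans (lebesgue_measure_itv _) _; rewrite /= lte_fin.
by have := ab ord0; rewrite le_eqVlt => /predU1P[->|->//]; rewrite ltxx subrr.
Qed.

End lebesgue_row.

Section euclidean.
Context {R : realType} {d : nat}.
Implicit Types (u v x : 'rV[R]_d) (f : 'rV[R]_d -> R).

Definition dotr u v : R := \sum_(i < d) u ord0 i * v ord0 i.

(* The norm `|u| that the library puts on 'rV[R]_d is the sup norm. *)
Definition enorm u : R := Num.sqrt (dotr u u).

Definition gradient f x : 'rV[R]_d := \row_i 'D_(delta_mx ord0 i) f x.

Definition C1 f : Prop :=
  (forall x, differentiable f x) /\ continuous (gradient f).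

Definition fm_class : set ('rV[R]_d -> R) :=
  [set f : 'rV[R]_d -> R | C1 f /\
    (ereal_sup (range (fun x => `|f x|%:E)) +
     ereal_sup (range (fun x => (enorm (gradient f x))%:E)) <= 1)%E].

Definition tv_class : set ('rV[R]_d -> R) :=
  [set f : 'rV[R]_d -> R | measurable_fun setT f /\ forall x, `|f x| <= 1].

End euclidean.

(* X1 and X2 may live on different probability spaces. Both distances take
   values in [0, 2]. At dFM = 0 the quantity dFM * |ln dFM| ^ k is 0, by
   lne 0 = -oo and 0 * +oo = 0. At dFM = 1, a value that non-identical laws
   do attain, it is 0 as well: an upper bound of this form can only be uniform
   over laws whose dFM stays away from 1. *)
Section distances.
Context {R : realType} {d : nat} {d1 d2 : measure_display}.
Context {T1 : measurableType d1} {T2 : measurableType d2}.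
Variables (P1 : probability T1 R) (P2 : probability T2 R).
Variables (X1 : {RV P1 >-> 'rV[R]_d}) (X2 : {RV P2 >-> 'rV[R]_d}).

Definition integral_distance (F : set ('rV[R]_d -> R)) : \bar R :=
  ereal_sup [set `|'E_P1[f \o X1] - 'E_P2[f \o X2]|%E | f in F].

Definition dFM : \bar R := integral_distance fm_class.

Definition dTV : \bar R := integral_distance tv_class.

End distances.

Section fourier.
Context {R : realType}.
Local Open Scope complex_scope.

Definition expi (t : R) : R[i] := cos t +i* sin t.

Definition cintegral {disp} {T : measurableType disp}
    (mu : {measure set T -> \bar R}) (f : T -> R[i]) : R[i] :=
  (\int[mu]_x complex.Re (f x)) +i* (\int[mu]_x complex.Im (f x)).

Context {d : nat}.

Definition charfun {disp} {T : measurableType disp} (P : probability T R)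
    (X : {RV P >-> 'rV[R]_d}) (u : 'rV[R]_d) : R[i] :=
  cintegral P (fun w => expi (dotr u (X w))).

Definition inverse_fourier (phi : 'rV[R]_d -> R[i]) (x : 'rV[R]_d) : R[i] :=
  ((2 * pi) ^- d)%:C *
  cintegral (lebesgue_row d) (fun u => expi (- dotr u x) * phi u).

Definition is_density {disp} {T : measurableType disp} (P : probability T R)
    (X : {RV P >-> 'rV[R]_d}) (f : 'rV[R]_d -> R) : Prop :=
  [/\ measurable_fun setT f, (forall x, 0 <= f x) &
      forall A, measurable A ->
        distribution P X A = (\int[lebesgue_row d]_(x in A) (f x)%:E)%E].

End fourier.

(* Main.v *)
From HB Require Import structures.
Require Import Defs.
From mathcomp Require Import all_boot all_order all_algebra.
From mathcomp Require Import complex.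
From mathcomp Require Import all_classical all_reals all_analysis.
From mathcomp Require Import ring lra measurable_realfun.
Import Order.TTheory GRing.Theory Num.Theory.
Import numFieldNormedType.Exports.
Local Open Scope classical_set_scope.
Local Open Scope ring_scope.

Set Implicit Arguments.
Unset Strict Implicit.
Unset Printing Implicit Defensive.

(* With the Poisson kernel K_s(u) = prod_i exp(-s |u_i|), Tonelli gives
   int K_s(u) e^{-i<u,z>} phi(u) du = E prod_i 2s / (s^2 + (X_i - z_i)^2).
   Letting s -> 0, the inverse Fourier transform f of phi is a pointwise limit of
   densities of X plus Cauchy noise, hence real and nonnegative. Integrating over
   half-open boxes identifies f as the density of X.
   The functions cos(<u,x> + t) / (1 + |u|) belong to the Fortet-Mourier class, so
   |phi_1(u) - phi_2(u)| <= (1 + |u|) d_FM. Using this on the cube of half-side A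
   and the exponential integrability of phi_1, phi_2 outside of it bounds
   |f_1 - f_2|; integrating that bound over the same cube, with the exponential
   moments of X_1, X_2 outside, bounds d_TV. The choice A = |ln d_FM| / r balances
   the two contributions. *)

(** Integrability of phi says nothing about the sign of its inverse transform; the smoothing
    supplies it. All Fourier integrals are written with the real quantity E cos(<u,X> + t), t free:
    t = 0 and t = -pi/2 recover the real and imaginary parts of phi, and for the phase t - <u,z> the
    smoothed integral is a nonnegative quantity times cos t, so one limit settles both the sign and
    the realness of f. The kernel is a product over the coordinates, not a function of the Euclidean
    norm of u, because its transform then factors into one-dimensional integrals with closed forms.
    The law of X might a priori charge the faces of a box; a shift of the smoothed density that
    dominates the noise scale decides on which side each face falls. The factor |ln d_FM| vanishes
    at d_FM = 1, so the constants involve delta, the distance kept from 1. The cutoff |ln d_FM| / r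
    serves below 1; above 1 the cutoff is 0 and only a multiple of C has to be absorbed; d_FM = 0 is
    settled by letting A tend to infinity, which shows that the two laws agree. *)

Lemma ge0_integral_reflect (R : realType) (g : R -> \bar R) :
  measurable_fun [set: R] g -> (forall x, 0 <= g x)%E ->
  (\int[lebesgue_measure]_x g x =
   \int[lebesgue_measure]_(x in `[0%R, +oo[) (g x + g (- x)%R))%E.
Proof.
move=> mg g0.
have mgN : measurable_fun [set: R] (fun x : R => g (- x)).
  exact: measurableT_comp mg _.
rewrite ge0_integralD//; [|exact: measurable_funTS..].
rewrite (ge0_integration_by_substitution0 mgN (fun x => g0 (- x))).
under [X in (_ + X)%E]eq_integral do rewrite opprK.
rewrite -[in LHS](setUv (`[0%R, +oo[%classic : set R)) ge0_integral_setU//=; first last.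
- by apply/disj_set2P; rewrite setICr.
- exact: measurable_funTS.
- exact: measurableC.
congr (_ + _)%E; rewrite setCitvr integral_itv_bndo_bndc//.
exact: measurable_funTS.
Qed.

(** * The Poisson kernel *)

Section poisson1.
Context {R : realType}.
Implicit Types (s y t a b : R).

(* The density of the Cauchy law of scale s is pi^-1 * cauchy s. *)
Definition cauchy s y : R := s / (s ^+ 2 + y ^+ 2).

Lemma cauchy_den_gt0 s y : 0 < s -> 0 < s ^+ 2 + y ^+ 2.
Proof. by move=> s0; rewrite ltr_wpDr ?sqr_ge0// exprn_gt0. Qed.

Lemma cauchy_ge0 s y : 0 < s -> 0 <= cauchy s y.
Proof. by move=> s0; rewrite divr_ge0 ?ltW// cauchy_den_gt0. Qed.

Lemma cauchy_le s y : 0 < s -> cauchy s y <= s^-1.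
Proof.
move=> s0; rewrite ler_pdivrMr ?cauchy_den_gt0// mulrDr expr2 mulKf ?gt_eqF//.
by rewrite lerDl mulr_ge0 ?sqr_ge0// invr_ge0 ltW.
Qed.

Lemma norm_cos_le1 y : `|cos y| <= 1.
Proof. by rewrite ler_norml cos_geN1 cos_le1. Qed.

Lemma norm_sin_le1 y : `|sin y| <= 1.
Proof. by rewrite ler_norml sin_geN1 sin_le1. Qed.

Lemma continuous_cos_affine y t : continuous (fun u : R => cos (u * y + t)).
Proof.
move=> u; apply: (@continuous_comp R R R (fun u => u * y + t) cos); last exact: continuous_cos.
by apply: cvgD; [apply: cvgM; [exact: cvg_id|exact: cvg_cst]|exact: cvg_cst].
Qed.

Lemma cvg_expRNM s : 0 < s -> expR (- (s * u)) @[u --> +oo] --> (0 : R).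
Proof.
move=> s0; apply: (@cvg_comp _ _ _ (fun u => s * u) (fun z => expR (- z)) _ (pinfty_nbhs R)).
  exact: gt0_cvgMry.
exact: cvgr_expR.
Qed.

(** An explicit primitive that vanishes at infinity. The condition [|b| <= a] makes the integrand
    nonnegative, as the fundamental theorem of calculus on a half-line is used for nonnegative
    functions. *)
Lemma integral_exp_cos s y a b : 0 < s -> `|b| <= a ->
  (\int[lebesgue_measure]_(u in `[0%R, +oo[)
     (expR (- (s * u)) * (a + b * cos (u * y)))%:E =
   (a / s + b * cauchy s y)%:E)%E.
Proof.
move=> s0 ba; have den := cauchy_den_gt0 y s0.
have a0 : 0 <= a by apply: le_trans ba.
pose f u := expR (- (s * u)) * (a + b * cos (u * y)).
(* The derivative of e^{-su} (y sin(uy) - s cos(uy)) is (s^2 + y^2) e^{-su} cos(uy). *)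
pose h u := - (a / s) + b / (s ^+ 2 + y ^+ 2) * (y * sin (u * y) - s * cos (u * y)).
pose F u := expR (- (s * u)) * h u.
have dF (u : R) : is_derive u 1 F (f u).
  rewrite /F /h; apply: is_derive_eq.
  rewrite /GRing.scale/= /f; field; rewrite !gt_eqF//=.
have cf : continuous f.
  move=> u; apply: cvgM.
    apply: (@continuous_comp _ _ _ (fun u => - (s * u)) expR); last exact: continuous_expR.
    by apply: cvgN; apply: cvgM; [exact: cvg_cst|exact: cvg_id].
  apply: cvgD; first exact: cvg_cst.
  apply: cvgM; first exact: cvg_cst.
  have := @continuous_cos_affine y 0 u.
  by under [in X in X -> _]eq_fun do rewrite addr0.
rewrite (@ge0_continuous_FTC2y _ f F 0 0).
- rewrite -EFinB; congr (_%:E); rewrite /F /h mulr0 oppr0 expR0 mul0r sin0 cos0 /cauchy.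
  by field; rewrite !gt_eqF.
- move=> u _; rewrite mulr_ge0 ?expR_ge0//.
  have : `|b * cos (u * y)| <= a.
    by rewrite normrM (le_trans _ ba)// ler_piMr// norm_cos_le1.
  by rewrite ler_norml => /andP[+ _]; rewrite -subr_ge0 opprK addrC.
- exact: continuous_subspaceT.
- pose M := a / s + `|b / (s ^+ 2 + y ^+ 2)| * (`|y| + s).
  have bnd u : `|F u| <= M * expR (- (s * u)).
    rewrite /F normrM ger0_norm ?expR_ge0// mulrC ler_wpM2r ?expR_ge0//.
    rewrite (le_trans (ler_normD _ _))// normrN (ger0_norm (divr_ge0 a0 (ltW s0))).
    rewrite /M lerD2l normrM ler_wpM2l// (le_trans (ler_normB _ _))//.
    rewrite !normrM (gtr0_norm s0) lerD// ler_piMr// ?norm_sin_le1 ?norm_cos_le1//.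
    exact: ltW.
  have M0 : M * expR (- (s * u)) @[u --> +oo] --> (0 : R).
    by rewrite -(mulr0 M); apply: cvgMr; exact: cvg_expRNM.
  apply/norm_cvg0P; apply: (squeeze_cvgr _ _ M0); last exact: cvg_cst.
  by apply: nearW => u; rewrite normr_ge0 bnd.
- by move=> u _; apply: ex_derive; exact: dF.
- apply: cvg_at_right_filter; apply: differentiable_continuous.
  by apply/derivable1_diffP; apply: ex_derive; exact: dF.
- by move=> u _; rewrite derive1E; apply: derive_val.
Qed.

(** Pairing u with -u cancels the sines: cos(uy + t) + cos(-uy + t) = 2 cos t cos(uy). The phase t
    thus leaves the integral as the factor cos t. *)
Lemma poisson_integral s y t a b : 0 < s -> `|b| <= a ->
  (\int[lebesgue_measure]_u
     (expR (- (s * `|u|)) * (a + b * cos (u * y + t)))%:E =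
   (a * (2 / s) + b * (2 * cauchy s y) * cos t)%:E)%E.
Proof.
move=> s0 ba.
have bc z : `|b * cos z| <= a.
  by rewrite normrM (le_trans _ ba)// ler_piMr// norm_cos_le1.
rewrite ge0_integral_reflect; last first.
- move=> u; rewrite lee_fin mulr_ge0 ?expR_ge0//.
  by have := bc (u * y + t); rewrite ler_norml => /andP[+ _]; rewrite -subr_ge0 opprK addrC.
- apply/measurable_EFinP; apply: continuous_measurable_fun => u; apply: cvgM.
    apply: (@continuous_comp _ _ _ (fun u => - (s * `|u|)) expR); last exact: continuous_expR.
    by apply: cvgN; apply: cvgM; [exact: cvg_cst|exact: norm_continuous].
  apply: cvgD; first exact: cvg_cst.
  apply: cvgM; first exact: cvg_cst.
  exact: continuous_cos_affine.
transitivity (\int[lebesgue_measure]_(u in `[0%R, +oo[)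
    (expR (- (s * u)) * ((2 * a) + (2 * (b * cos t)) * cos (u * y)))%:E)%E.
  apply: eq_integral => u; rewrite inE/= in_itv/= andbT => u0.
  rewrite normrN ger0_norm// -EFinD; congr (_%:E).
  by rewrite mulNr !cosD cosN sinN; ring.
rewrite integral_exp_cos//; first by congr (_%:E); ring.
by rewrite normrM ger0_norm// ler_wpM2l.
Qed.

Lemma cauchy_box s a b x : 0 < s -> a < b ->
  (\int[lebesgue_measure]_(z in `[a, b]) (pi^-1 * cauchy s (x - z))%:E =
   (pi^-1 * (atan ((b - x) / s) - atan ((a - x) / s)))%:E)%E.
Proof.
move=> s0 ab; move: (pi^-1 : R) => p; pose F z := p * atan ((z - x) / s) : R.
pose f z := p * cauchy s (x - z) : R.
have dF (z : R) : is_derive z 1 F (f z).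
  rewrite /F; apply: is_derive_eq.
  rewrite /GRing.scale/= /f /cauchy; field.
  by rewrite !gt_eqF ?cauchy_den_gt0.
have cF (z : R) : {for z, continuous F}.
  apply: differentiable_continuous.
  by apply/derivable1_diffP; apply: ex_derive; exact: dF.
rewrite (@continuous_FTC2 _ f F)//.
- by rewrite -EFinB /F mulrBr.
- apply: continuous_subspaceT => z; rewrite /f /cauchy.
  apply: cvgM; first exact: cvg_cst.
  apply: cvgM; first exact: cvg_cst.
  apply: cvgV; first by rewrite gt_eqF// cauchy_den_gt0.
  apply: cvgD; first exact: cvg_cst.
  by rewrite !expr2; apply: cvgM; apply: cvgB; (exact: cvg_cst || exact: cvg_id).
- split.
  + by move=> z _; apply: ex_derive; exact: dF.
  + by apply: cvg_at_right_filter; exact: cF.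
  + by apply: cvg_at_left_filter; exact: cF.
- by move=> z _; rewrite derive1E; apply: derive_val.
Qed.

End poisson1.

(** * Integration over R^n one coordinate at a time *)

Section row_integral.
Context {R : realType}.

(** [lebesgue_row n.+1] is by definition the image of a product measure under [row_cons]: a change
    of variables, then Tonelli. *)
Lemma ge0_integral_row_cons n (f : 'rV[R]_n.+1 -> \bar R) :
  measurable_fun setT f -> (forall x, 0 <= f x)%E ->
  (\int[lebesgue_row n.+1]_v f v =
   \int[lebesgue_measure]_x \int[lebesgue_row n]_v f (row_cons (x, v)))%E.
Proof.
move=> mf f0.
transitivity (\int[pushforward (@lebesgue_measure R \x lebesgue_row n)%E (@row_cons R n)]_v f v)%E.
  by [].
rewrite ge0_integral_pushforward//; last exact: measurable_row_cons.
rewrite preimage_setT fubini_tonelli1//.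
  exact: measurableT_comp mf (@measurable_row_cons R n).
by move=> p; exact: f0.
Qed.

Lemma integral_row0 (f : 'rV[R]_0 -> \bar R) : measurable_fun setT f ->
  (\int[lebesgue_row 0]_v f v = f 0%R)%E.
Proof. by move=> mf; rewrite [LHS]integral_dirac// diracT mul1e. Qed.

Lemma dotr_row_cons n (p : measurableTypeR R * 'rV[R]_n) (y : 'rV[R]_n.+1) :
  dotr (row_cons p) y = p.1 * y ord0 ord0 + dotr p.2 (\row_i y ord0 (lift ord0 i)).
Proof.
rewrite /dotr big_ord_recl row_cons0; congr (_ + _).
by apply: eq_bigr => i _; rewrite row_consS mxE.
Qed.

Lemma measurable_dotr {disp} {T : measurableType disp} n (f g : T -> 'rV[R]_n) :
  measurable_fun setT f -> measurable_fun setT g ->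
  measurable_fun setT (fun w => dotr (f w) (g w)).
Proof.
move=> /measurable_fun_coorP mf /measurable_fun_coorP mg.
by apply: measurable_sum => i; apply: measurable_funM.
Qed.

Lemma measurable_enorm {disp} {T : measurableType disp} n (f : T -> 'rV[R]_n) :
  measurable_fun setT f -> measurable_fun setT (fun w => enorm (f w)).
Proof.
move=> mf; apply: (@measurableT_comp _ _ _ _ _ _ (Num.sqrt : R -> R)).
  by apply: continuous_measurable_fun; exact: sqrt_continuous.
exact: measurable_dotr.
Qed.

Lemma measurable_cos_comp {disp} {T : measurableType disp} (f : T -> R) :
  measurable_fun setT f -> measurable_fun setT (fun w => cos (f w)).
Proof.
move=> mf; apply: (@measurableT_comp _ _ _ _ _ _ cos) => //.
by apply: continuous_measurable_fun; exact: continuous_cos.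
Qed.

Lemma measurable_cauchy {disp} {T : measurableType disp} s (f : T -> R) : 0 < s ->
  measurable_fun setT f -> measurable_fun setT (fun w => cauchy s (f w)).
Proof.
move=> s0 mf; apply: (@measurableT_comp _ _ _ _ _ _ (cauchy s)) => //.
apply: continuous_measurable_fun => z; rewrite /cauchy.
apply: cvgM; first exact: cvg_cst.
apply: cvgV; first by rewrite gt_eqF// cauchy_den_gt0.
apply: cvgD; first exact: cvg_cst.
by rewrite expr2; apply: cvgM; exact: cvg_id.
Qed.

Definition poisson_kernel n s (u : 'rV[R]_n) : R :=
  \prod_(i < n) expR (- (s * `|u ord0 i|)).

Lemma poisson_kernel_ge0 n s (u : 'rV[R]_n) : 0 <= poisson_kernel s u.
Proof. by apply: prodr_ge0 => i _; exact: expR_ge0. Qed.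

Lemma poisson_kernel_le1 n s (u : 'rV[R]_n) : 0 < s -> poisson_kernel s u <= 1.
Proof.
move=> s0; apply: prodr_ile1 => i _; rewrite expR_ge0 -expR0 ler_expR oppr_le0.
by rewrite mulr_ge0// ltW.
Qed.

Lemma poisson_kernel_cons n s (p : measurableTypeR R * 'rV[R]_n) :
  poisson_kernel s (row_cons p) = expR (- (s * `|p.1|)) * poisson_kernel s p.2.
Proof.
rewrite /poisson_kernel big_ord_recl row_cons0; congr (_ * _).
by apply: eq_bigr => i _; rewrite row_consS.
Qed.

Lemma measurable_poisson_kernel n s :
  measurable_fun [set: 'rV[R]_n] (poisson_kernel s).
Proof.
apply: measurable_prod => i _.
apply: (@measurableT_comp _ _ _ _ _ _ expR) => //.
apply: (@measurableT_comp _ _ _ _ _ _ (-%R : R -> R)) => //.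
apply: measurable_funM => //.
apply: (@measurableT_comp _ _ _ _ _ _ (@Num.norm R R)) => //.
exact: measurable_coor.
Qed.

(* Adding a constant a >= |b| keeps the integrand nonnegative, so that Tonelli applies;
   this shape is preserved by integrating out one coordinate. *)
Lemma poisson_row_integral n s (y : 'rV[R]_n) t a b : 0 < s -> `|b| <= a ->
  (\int[lebesgue_row n]_u
     (poisson_kernel s u * (a + b * cos (dotr u y + t)))%:E =
   (a * (2 / s) ^+ n + b * (\prod_(i < n) (2 * cauchy s (y ord0 i))) * cos t)%:E)%E.
Proof.
move=> s0.
have mf m (z : 'rV[R]_m) t' a' b' : measurable_fun [set: 'rV[R]_m]
    (fun u => (poisson_kernel s u * (a' + b' * cos (dotr u z + t')))%:E).
  apply/measurable_EFinP/measurable_funM; first exact: measurable_poisson_kernel.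
  apply: measurable_funD => //; apply: measurable_funM => //.
  apply: measurable_cos_comp; apply: measurable_funD => //.
  exact: measurable_dotr.
have f0 m (z : 'rV[R]_m) t' a' b' u : `|b'| <= a' ->
    (0 <= (poisson_kernel s u * (a' + b' * cos (dotr u z + t')))%:E)%E.
  move=> ba; rewrite lee_fin mulr_ge0 ?poisson_kernel_ge0//.
  have : `|b' * cos (dotr u z + t')| <= a'.
    by rewrite normrM (le_trans _ ba)// ler_piMr// norm_cos_le1.
  by rewrite ler_norml => /andP[+ _]; rewrite -subr_ge0 opprK addrC.
elim: n y t a b => [|n IH] y t a b ba.
  rewrite integral_row0; last exact: mf.
  by rewrite /poisson_kernel /dotr !big_ord0 expr0 add0r mul1r !mulr1.
(* Since 2 [cauchy] is at most 2/s, integrating out n coordinates turns a into a (2/s)^n and b into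
   some b' with |b'| <= a (2/s)^n: the condition for the remaining one-dimensional integral. *)
have prodle m (z : 'I_m -> R) : 0 <= \prod_(i < m) (2 * cauchy s (z i)) <= (2 / s) ^+ m.
  have c0 i : 0 <= 2 * cauchy s (z i) by rewrite mulr_ge0// cauchy_ge0.
  rewrite prodr_ge0//= -[X in _ ^+ X](card_ord m) -prodr_const.
  by apply: ler_prod => i _; rewrite c0 ler_wpM2l// cauchy_le.
rewrite ge0_integral_row_cons; [|exact: mf|by move=> u; exact: f0].
pose z : 'rV[R]_n := \row_i y ord0 (lift ord0 i).
pose b' := b * \prod_(i < n) (2 * cauchy s (z ord0 i)).
transitivity (\int[lebesgue_measure]_x (expR (- (s * `|x|)) *
   (a * (2 / s) ^+ n + b' * cos (x * y ord0 ord0 + t)))%:E)%E.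
  apply: eq_integral => x _.
  rewrite EFinM -(IH z _ _ _ ba) -ge0_integralZl_EFin ?expR_ge0//.
  - by apply: eq_integral => v _;
      rewrite poisson_kernel_cons dotr_row_cons /= -EFinM mulrA addrA [_ + dotr _ _]addrC -addrA.
  - by move=> v _; exact: f0.
  - exact: mf.
rewrite poisson_integral//; last first.
  have /andP[p0 p1] := prodle _ (fun i => z ord0 i).
  by rewrite normrM (ger0_norm p0) ler_pM.
rewrite big_ord_recl /b' exprS; congr (_%:E).
under eq_bigr do rewrite mxE.
by ring.
Qed.

Lemma prod_row_integral n (g : 'I_n -> R -> R) (I : 'I_n -> R) :
  (forall i, measurable_fun [set: R] (g i)) -> (forall i x, 0 <= g i x) ->
  (forall i, \int[lebesgue_measure]_x (g i x)%:E = (I i)%:E)%E ->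
  (\int[lebesgue_row n]_u (\prod_(i < n) g i (u ord0 i))%:E = (\prod_(i < n) I i)%:E)%E.
Proof.
have mp m (h : 'I_m -> R -> R) : (forall i, measurable_fun [set: R] (h i)) ->
    measurable_fun setT (fun u : 'rV[R]_m => (\prod_(i < m) h i (u ord0 i))%:E).
  move=> mh; apply/measurable_EFinP/measurable_prod => i _.
  exact: measurableT_comp (mh i) (measurable_coor i).
elim: n g I => [|n IH] g I mg g0 gI.
  by rewrite integral_row0 ?big_ord0//; exact: mp.
rewrite ge0_integral_row_cons; [|exact: mp|by move=> u; rewrite lee_fin prodr_ge0].
have IHn := IH _ _ (fun i => mg (lift ord0 i)) (fun i => g0 (lift ord0 i))
  (fun i => gI (lift ord0 i)).
rewrite big_ord_recl EFinM -gI -IHn muleC -ge0_integralZl//.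
- apply: eq_integral => x _; rewrite muleC -ge0_integralZl_EFin//.
  + apply: eq_integral => v _; rewrite -EFinM big_ord_recl row_cons0; congr (_ * _)%:E.
    by apply: eq_bigr => i _; rewrite row_consS.
  + by move=> v _; rewrite lee_fin prodr_ge0.
  + exact: (mp _ (fun i => g (lift ord0 i)) (fun i => mg _)).
- by apply/measurable_EFinP; exact: mg.
- by move=> x _; rewrite lee_fin.
- by apply: integral_ge0 => v _; rewrite lee_fin prodr_ge0.
Qed.

End row_integral.

(** * Fourier inversion *)

Lemma dominated_Rintegral {disp} {T : measurableType disp} {R : realType}
    (mu : {measure set T -> \bar R}) (D : set T) (h : nat -> T -> R) (f g : T -> R) :
  measurable D -> (forall n, measurable_fun D (h n)) -> measurable_fun D f ->
  (forall x, D x -> h n x @[n --> \oo] --> f x) ->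
  mu.-integrable D (EFin \o g) -> (forall n x, D x -> `|h n x| <= g x) ->
  (\int[mu]_(x in D) h n x) @[n --> \oo] --> \int[mu]_(x in D) f x.
Proof.
move=> mD mh mf hf ig hg.
have cE x : D x -> (h n x)%:E @[n --> \oo] --> (f x)%:E.
  by move=> Dx; apply/fine_cvgP; split; [exact: nearW|exact: hf].
have [if_ _ cv] := @dominated_convergence _ _ _ mu D mD (fun n => EFin \o h n)
  (EFin \o f) (EFin \o g) (fun n => measurableT_comp (@EFin_measurable _ _) (mh n))
  (measurableT_comp (@EFin_measurable _ _) mf)
  (aeW _ cE) ig (aeW _ (fun x n Dx => hg n x Dx)).
apply: fine_cvg; rewrite fineK; first exact: cv.
exact: integrable_fin_num.
Qed.

Lemma integrable_scale {disp} {T : measurableType disp} {R : realType}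
    (mu : {measure set T -> \bar R}) (D : set T) (k : R) (f : T -> R) :
  measurable D -> mu.-integrable D (EFin \o f) ->
  mu.-integrable D (fun x => (k * f x)%:E).
Proof.
move=> mD /(integrableZl mD k) ikf.
by apply: eq_integrable ikf => // x _; rewrite EFinM.
Qed.

Lemma integrable_add {disp} {T : measurableType disp} {R : realType}
    (mu : {measure set T -> \bar R}) (D : set T) (f g : T -> R) :
  measurable D -> mu.-integrable D (EFin \o f) -> mu.-integrable D (EFin \o g) ->
  mu.-integrable D (fun x => (f x + g x)%:E).
Proof.
by move=> mD if_ ig; apply: eq_integrable (integrableD mD if_ ig).
Qed.

Section characteristic_function.
Context {R : realType} {d : nat} {disp : measure_display} {T : measurableType disp}.
Variables (P : probability T R) (X : {RV P >-> 'rV[R]_d}).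
Local Notation phi := (charfun X).
Local Notation nphi u := (ComplexField.Normc.normc (charfun X u)).

Lemma integrable_bounded (f : T -> R) M : measurable_fun setT f ->
  (forall w, `|f w| <= M) -> P.-integrable setT (EFin \o f).
Proof.
move=> mf fM; apply: (@le_integrable _ _ _ P setT measurableT _ (EFin \o cst M)).
- exact/measurable_EFinP.
- by move=> w _; rewrite /= lee_fin (le_trans (fM w))// ler_norm.
- exact: finite_measure_integrable_cst.
Qed.

Lemma mean_cst (M : R) : \int[P]_w M = M.
Proof.
rewrite Rintegral_cst//; transitivity (M * fine 1%E); last exact: mulr1.
by congr (_ * fine _); exact: probability_setT.
Qed.

Lemma measurable_rv : measurable_fun setT (X : T -> 'rV[R]_d).
Proof. exact: measurable_funPT. Qed.

Lemma measurable_dotr_rv u : measurable_fun setT (fun w => dotr u (X w)).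
Proof. by apply: measurable_dotr => //; exact: measurable_rv. Qed.

(* The real part of e^{it} phi(u). *)
Definition phase u t : R := \int[P]_w cos (dotr u (X w) + t).

Lemma integrable_cos_rv u t : P.-integrable setT (fun w => (cos (dotr u (X w) + t))%:E).
Proof.
apply: (@integrable_bounded _ 1) => [|w]; last exact: norm_cos_le1.
by apply: measurable_cos_comp; apply: measurable_funD => //; exact: measurable_dotr_rv.
Qed.

Lemma phase0 u : phase u 0 = complex.Re (phi u).
Proof. by rewrite /phase; apply: eq_Rintegral => w _; rewrite addr0. Qed.

Lemma phaseNpihalf u : phase u (- (pi / 2)) = complex.Im (phi u).
Proof. by rewrite /phase; apply: eq_Rintegral => w _; rewrite cosBpihalf. Qed.

Lemma phaseE u t : phase u t = cos t * complex.Re (phi u) - sin t * complex.Im (phi u).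
Proof.
have ic : P.-integrable setT (fun w => (cos (dotr u (X w)))%:E).
  by under eq_fun do rewrite -[dotr _ _]addr0; exact: integrable_cos_rv.
have is_ : P.-integrable setT (fun w => (sin (dotr u (X w)))%:E).
  by under eq_fun do rewrite -cosBpihalf; exact: integrable_cos_rv.
rewrite -[complex.Re _]/(\int[P]_w cos (dotr u (X w))).
rewrite -[complex.Im _]/(\int[P]_w sin (dotr u (X w))).
rewrite -!RintegralZl// -RintegralB//; [|exact: integrable_scale..].
by apply: eq_Rintegral => w _; rewrite cosD mulrC [sin t * _]mulrC.
Qed.

Lemma normcE u : nphi u = Num.sqrt (complex.Re (phi u) ^+ 2 + complex.Im (phi u) ^+ 2).
Proof. by case: (phi u). Qed.

Lemma norm_phase u t : `|phase u t| <= nphi u.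
Proof.
rewrite phaseE normcE -sqrtr_sqr ler_wsqrtr//.
(* Lagrange's identity, with cos^2 t + sin^2 t = 1. *)
rewrite -subr_ge0 (_ : _ - _ =
  (sin t * complex.Re (phi u) + cos t * complex.Im (phi u)) ^+ 2) ?sqr_ge0//.
by have := cos2Dsin2 t; nra.
Qed.

Lemma norm_phase_le1 u t : `|phase u t| <= 1.
Proof.
rewrite (le_trans (le_normr_Rintegral _ (integrable_cos_rv u t)))//.
rewrite -[leRHS](mean_cst 1); apply: le_Rintegral => //.
- exact/integrable_norm/integrable_cos_rv.
- exact: finite_measure_integrable_cst.
- by move=> w _; exact: norm_cos_le1.
Qed.

Lemma measurable_cos_joint (h : 'rV[R]_d -> R) : measurable_fun setT h ->
  measurable_fun setT (fun p : 'rV[R]_d * T => cos (dotr p.1 (X p.2) + h p.1)).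
Proof.
move=> mh; apply: measurable_cos_comp; apply: measurable_funD.
  apply: measurable_dotr => //.
  exact: measurableT_comp measurable_rv measurable_snd.
exact: measurableT_comp mh measurable_fst.
Qed.

(** Adding 1 to the cosine makes the integrand nonnegative, so the measurability part of Tonelli
    applies; P has mass 1, hence the 1 is subtracted again. The phase may depend on u because it is
    later taken to be t - <u,z>. *)
Lemma measurable_phase (h : 'rV[R]_d -> R) : measurable_fun setT h ->
  measurable_fun setT (fun u => phase u (h u)).
Proof.
move=> mh.
have -> : (fun u => phase u (h u)) =
    (fun u => fine (fubini_F P (fun p => (1 + cos (dotr p.1 (X p.2) + h p.1))%:E) u) - 1).
  apply/funext => u; rewrite /fubini_F -[fine _]/(\int[P]_w (1 + cos (dotr u (X w) + h u))).
  rewrite RintegralD//; [|exact: finite_measure_integrable_cst|exact: integrable_cos_rv].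
  by rewrite mean_cst addrC addKr.
apply: measurable_funB => //; apply: (measurableT_comp (@fine_measurable _ _ _)) => //.
apply: measurable_fun_fubini_tonelli_F.
  apply/measurable_EFinP/measurable_funD => //; exact: measurable_cos_joint.
by move=> p; rewrite lee_fin -lerBlDl sub0r cos_geN1.
Qed.

Lemma measurable_normc_charfun : measurable_fun setT (fun u => nphi u).
Proof.
under eq_fun do rewrite normcE -phase0 -phaseNpihalf.
apply: (@measurableT_comp _ _ _ _ _ _ (Num.sqrt : R -> R)).
  by apply: continuous_measurable_fun; exact: sqrt_continuous.
by apply: measurable_funD; apply: measurable_funX; exact: measurable_phase.
Qed.

Lemma integrable_poisson_kernel s : 0 < s ->
  (lebesgue_row d).-integrable setT (fun u : 'rV[R]_d => (poisson_kernel s u)%:E).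
Proof.
move=> s0; apply/integrableP; split.
  by apply/measurable_EFinP; exact: measurable_poisson_kernel.
have := @poisson_row_integral R d s 0 0 1 0 s0.
rewrite normr0 => /(_ ler01) E.
under eq_integral => u _ do
  rewrite /= ger0_norm ?poisson_kernel_ge0// -[poisson_kernel s u]mulr1
    -[1 in X in X%:E]addr0 -(mul0r (cos (dotr u 0 + 0))).
by rewrite E ltry.
Qed.

Definition smoothed_mean s (z : 'rV[R]_d) : R :=
  \int[P]_w \prod_(i < d) cauchy s (X w ord0 i - z ord0 i).

Lemma measurable_cauchy_prod s (z : 'rV[R]_d) : 0 < s ->
  measurable_fun setT (fun w => \prod_(i < d) cauchy s (X w ord0 i - z ord0 i)).
Proof.
move=> s0; apply: measurable_prod => i _; apply: measurable_cauchy => //.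
apply: measurable_funB => //; exact: measurableT_comp (measurable_coor i) measurable_rv.
Qed.

Lemma cauchy_prod_bound s (y : 'I_d -> R) : 0 < s ->
  0 <= \prod_(i < d) cauchy s (y i) <= s^-1 ^+ d.
Proof.
move=> s0; rewrite prodr_ge0/=; last by move=> i _; exact: cauchy_ge0.
rewrite -[X in _ ^+ X](card_ord d) -prodr_const.
by apply: ler_prod => i _; rewrite cauchy_ge0// cauchy_le.
Qed.

Lemma integrable_cauchy_prod s (z : 'rV[R]_d) : 0 < s ->
  P.-integrable setT (fun w => (\prod_(i < d) cauchy s (X w ord0 i - z ord0 i))%:E).
Proof.
move=> s0; apply: (@integrable_bounded _ (s^-1 ^+ d)); first exact: measurable_cauchy_prod.
move=> w; have /andP[c0 c1] := cauchy_prod_bound (fun i => X w ord0 i - z ord0 i) s0.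
by rewrite ger0_norm.
Qed.

Lemma dotrBr n (u x y : 'rV[R]_n) : dotr u (x - y) = dotr u x - dotr u y.
Proof.
by rewrite /dotr -sumrB; apply: eq_bigr => i _; rewrite !mxE mulrBr.
Qed.

(** Tonelli for the nonnegative integrand K_s(u) (1 + cos(<u,X> + t - <u,z>)). The added 1
    contributes the mass (2/s)^d of the kernel to both iterated integrals and cancels. *)
Lemma poisson_mean s z t : 0 < s ->
  \int[lebesgue_row d]_u (poisson_kernel s u * phase u (t - dotr u z)) =
  2 ^+ d * smoothed_mean s z * cos t.
Proof.
move=> s0.
have mt : measurable_fun setT (fun u : 'rV[R]_d => t - dotr u z).
  by apply: measurable_funB => //; exact: measurable_dotr.
have ik : (lebesgue_row d).-integrable setT (EFin \o poisson_kernel s).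
  exact: integrable_poisson_kernel.
have ip : (lebesgue_row d).-integrable setT
    (EFin \o (fun u => poisson_kernel s u * phase u (t - dotr u z))).
  apply: (le_integrable _ _ _ ik) => //.
    apply/measurable_EFinP/measurable_funM; first exact: measurable_poisson_kernel.
    exact: measurable_phase.
  by move=> u _; rewrite lee_fin/= normrM ler_piMr// norm_phase_le1.
have icp := integrable_cauchy_prod z s0.
pose g (p : 'rV[R]_d * T) :=
  (poisson_kernel s p.1 * (1 + cos (dotr p.1 (X p.2) + (t - dotr p.1 z))))%:E.
have mg : measurable_fun setT g.
  apply/measurable_EFinP/measurable_funM.
    exact: (measurableT_comp (@measurable_poisson_kernel R d s) measurable_fst).
  by apply: measurable_funD => //; exact: (measurable_cos_joint mt).
have g0 p : (0 <= g p)%E.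
  by rewrite lee_fin mulr_ge0 ?poisson_kernel_ge0// -lerBlDl sub0r cos_geN1.
have /= E := fubini_tonelli (m1 := lebesgue_row d) (m2 := P) g mg g0.
have l u : (\int[P]_w g (u, w) =
    (poisson_kernel s u + poisson_kernel s u * phase u (t - dotr u z))%:E)%E.
  rewrite -[X in (X + _)%R]mulr1 -mulrDr -(mean_cst 1) -RintegralD//; first last.
  - exact: integrable_cos_rv.
  - exact: finite_measure_integrable_cst.
  have iD : P.-integrable setT
      (EFin \o (fun w => 1 + cos (dotr u (X w) + (t - dotr u z)))).
    apply: integrable_add => //; first exact: finite_measure_integrable_cst.
    exact: integrable_cos_rv.
  by rewrite -RintegralZl// /Rintegral fineK// integrable_fin_num// integrable_scale.
have r w : (\int[lebesgue_row d]_u g (u, w) =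
    ((2 / s) ^+ d + 2 ^+ d * (\prod_(i < d) cauchy s (X w ord0 i - z ord0 i)) * cos t)%:E)%E.
  have := @poisson_row_integral R d s (X w - z) t 1 1 s0.
  rewrite normr1 !mul1r => /(_ (lexx _)) E'.
  have pE : \prod_(i < d) (2 * cauchy s ((X w - z) ord0 i)) =
      2 ^+ d * \prod_(i < d) cauchy s (X w ord0 i - z ord0 i).
    rewrite big_split/= prodr_const card_ord; congr (_ * _).
    by apply: eq_bigr => i _; rewrite !mxE.
  rewrite -pE -E'.
  apply: eq_integral => u _; rewrite /g /= mul1r dotrBr.
  by congr (_ * (_ + cos _))%:E; ring.
have E2 : \int[lebesgue_row d]_u
      (poisson_kernel s u + poisson_kernel s u * phase u (t - dotr u z)) =
    \int[P]_w ((2 / s) ^+ d +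
      2 ^+ d * (\prod_(i < d) cauchy s (X w ord0 i - z ord0 i)) * cos t).
  rewrite /Rintegral; congr fine.
  by rewrite -(eq_integral _ _ (fun u _ => l u)) E; apply: eq_integral => w _; exact: r.
have E3 : \int[lebesgue_row d]_u poisson_kernel s u = (2 / s) ^+ d.
  have := @poisson_row_integral R d s 0 0 1 0 s0.
  rewrite normr0 => /(_ ler01) E3; rewrite /Rintegral.
  under eq_integral => u _ do rewrite -[poisson_kernel s u]mulr1
    -[1 in X in X%:E]addr0 -(mul0r (cos (dotr u 0 + 0))).
  by rewrite E3 /= !mul0r addr0 mul1r.
move: E2; rewrite RintegralD// E3 RintegralD//; first last.
- under eq_fun do rewrite mulrC.
  by do 2 apply: integrable_scale => //.
- exact: finite_measure_integrable_cst.
rewrite mean_cst => /addrI ->.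
by rewrite RintegralZr// ?RintegralZl//; exact: integrable_scale.
Qed.

End characteristic_function.

Lemma cvg_bigprod {R : realType} (I : Type) (r : seq I) (f : I -> nat -> R) (l : I -> R) :
  (forall i, f i n @[n --> \oo] --> l i) ->
  \prod_(i <- r) f i n @[n --> \oo] --> \prod_(i <- r) l i.
Proof.
move=> fl; elim: r => [|i r IH].
  by rewrite big_nil; under eq_fun do rewrite big_nil; exact: cvg_cst.
by rewrite big_cons; under eq_fun do rewrite big_cons; exact: cvgM.
Qed.

Lemma poisson_kernelE {R : realType} n s (u : 'rV[R]_n) :
  poisson_kernel s u = expR (- (s * \sum_(i < n) `|u ord0 i|)).
Proof. by rewrite /poisson_kernel mulr_sumr -sumrN expR_sum. Qed.

Lemma dotrDr_const {R : realType} n (u z : 'rV[R]_n) v :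
  dotr u (z + const_mx v) = dotr u z + v * \sum_(i < n) u ord0 i.
Proof.
rewrite /dotr mulr_sumr -big_split; apply: eq_bigr => i _.
by rewrite !mxE mulrDr [v * _]mulrC.
Qed.

(** * Realness and nonnegativity of the inverse Fourier transform *)

Section inversion.
Context {R : realType} {d : nat} {disp : measure_display} {T : measurableType disp}.
Context (P : probability T R) (X : {RV P >-> 'rV[R]_d}).
Local Notation nphi u := (ComplexField.Normc.normc (charfun X u)).
Context (iphi : (lebesgue_row d).-integrable setT (fun u => (nphi u)%:E)).

(* The real part of e^{it} times the inverse Fourier transform of phi at z. *)
Definition inv_phase (z : 'rV[R]_d) t : R :=
  (2 * pi) ^- d * \int[lebesgue_row d]_u phase X u (t - dotr u z).

(* The density of X plus independent Cauchy noise of scale s in each coordinate. *)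
Definition smoothed_density s (z : 'rV[R]_d) : R := pi ^- d * smoothed_mean X s z.

Lemma measurable_phase_shift z t :
  measurable_fun setT (fun u => phase X u (t - dotr u z)).
Proof.
apply: measurable_phase; apply: measurable_funB => //; exact: measurable_dotr.
Qed.

Lemma integrable_phase z t :
  (lebesgue_row d).-integrable setT (fun u => (phase X u (t - dotr u z))%:E).
Proof.
apply: (le_integrable measurableT _ _ iphi) => //.
  by apply/measurable_EFinP; exact: measurable_phase_shift.
move=> u _; rewrite /= lee_fin (le_trans (norm_phase _ _ _))//; exact: ler_norm.
Qed.

Lemma cvg_phase u (t : nat -> R) l : t n @[n --> \oo] --> l ->
  phase X u (t n) @[n --> \oo] --> phase X u l.
Proof.
move=> tl; rewrite phaseE; under eq_fun do rewrite phaseE.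
by apply: cvgB; apply: cvgM; (try exact: cvg_cst); apply: continuous_cvg => //;
  [exact: continuous_cos|exact: continuous_sin].
Qed.

Lemma smoothed_density_cos s z t : 0 < s ->
  smoothed_density s z * cos t =
  (2 * pi) ^- d * \int[lebesgue_row d]_u (poisson_kernel s u * phase X u (t - dotr u z)).
Proof.
move=> s0; rewrite poisson_mean// /smoothed_density exprMn.
have : pi ^+ d != 0 :> R by rewrite expf_neq0// gt_eqF// pi_gt0.
have : 2 ^+ d != 0 :> R by rewrite expf_neq0// pnatr_eq0.
move: (2 ^+ d : R) (pi ^+ d : R) => a b a0 b0.
by field; rewrite a0 b0.
Qed.

(** Dominated convergence under |phi|, since the kernel is at most 1. The point of evaluation may
    move along the diagonal: v = 0 gives the pointwise limits, and v = [harmonic] the shift used for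
    half-open boxes. *)
Lemma cvg_smoothed_density (s v : nat -> R) z t : (forall n, 0 < s n) ->
  s n @[n --> \oo] --> 0 -> v n @[n --> \oo] --> 0 ->
  smoothed_density (s n) (z + const_mx (v n)) * cos t @[n --> \oo] --> inv_phase z t.
Proof.
move=> s0 cs cv; under eq_fun do rewrite smoothed_density_cos//.
apply: cvgMr; apply: (@dominated_Rintegral _ _ _ _ _ _ _ (fun u => nphi u)) => //.
- move=> n; apply: measurable_funM; first exact: measurable_poisson_kernel.
  exact: measurable_phase_shift.
- exact: measurable_phase_shift.
- move=> u _; rewrite -[phase X u _]mul1r; apply: cvgM.
    under eq_fun do rewrite poisson_kernelE.
    have c : - (s n * \sum_(i < d) `|u ord0 i|) @[n --> \oo] -->
        - (0 * \sum_(i < d) `|u ord0 i|).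
      by apply: cvgN; apply: cvgM => //; exact: cvg_cst.
    rewrite mul0r oppr0 in c.
    by rewrite -expR0; apply: continuous_cvg => //; exact: continuous_expR.
  apply: cvg_phase; apply: cvgB; first exact: cvg_cst.
  under eq_fun do rewrite dotrDr_const.
  have c : dotr u z + v n * \sum_(i < d) u ord0 i @[n --> \oo] -->
      dotr u z + 0 * \sum_(i < d) u ord0 i.
    by apply: cvgD; [exact: cvg_cst|apply: cvgM => //; exact: cvg_cst].
  by rewrite mul0r addr0 in c.
- move=> n u _; rewrite normrM -[leRHS]mul1r ler_pM// ?norm_phase//.
  by rewrite ger0_norm ?poisson_kernel_ge0// poisson_kernel_le1.
Qed.

Lemma smoothed_density_ge0 s z : 0 < s -> 0 <= smoothed_density s z.
Proof.
move=> s0; apply: mulr_ge0; first by rewrite invr_ge0 exprn_ge0// pi_ge0.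
apply: Rintegral_ge0 => w _.
by have /andP[] := cauchy_prod_bound (fun i => X w ord0 i - z ord0 i) s0.
Qed.

(** The bound is uniform in s and z, so on a box it dominates all the smoothed densities at once. *)
Lemma smoothed_density_le s z : 0 < s ->
  smoothed_density s z <= (2 * pi) ^- d * \int[lebesgue_row d]_u nphi u.
Proof.
move=> s0; have -> : smoothed_density s z = smoothed_density s z * cos 0 by rewrite cos0 mulr1.
rewrite smoothed_density_cos//.
rewrite ler_wpM2l ?invr_ge0 ?exprn_ge0 ?mulr_ge0 ?pi_ge0//.
have ip := integrable_phase z 0.
apply: le_Rintegral => //.
- apply: (le_integrable measurableT _ _ ip) => //.
    apply/measurable_EFinP/measurable_funM; first exact: measurable_poisson_kernel.
    exact: measurable_phase_shift.
  move=> u _; rewrite /= lee_fin normrM ler_piMl//.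
  by rewrite ger0_norm ?poisson_kernel_ge0// poisson_kernel_le1.
- move=> u _; rewrite (le_trans (ler_norm _))// normrM -[leRHS]mul1r ler_pM ?norm_phase//.
  by rewrite ger0_norm ?poisson_kernel_ge0// poisson_kernel_le1.
Qed.

Let cvg_smoothed_density0 z t :
  smoothed_density (harmonic n) z * cos t @[n --> \oo] --> inv_phase z t.
Proof.
have := @cvg_smoothed_density harmonic (fun=> 0) z t (@harmonic_gt0 R)
  (@cvg_harmonic R) (@cvg_cst _ _ _ _ _).
have -> : const_mx 0 = 0 :> 'rV[R]_d by apply/rowP => i; rewrite !mxE.
by rewrite addr0; exact.
Qed.

(** Every smoothed approximation carries the factor cos(-pi/2) = 0. This is the vanishing of the
    imaginary part of the inverse transform. *)
Lemma inv_phaseNpihalf z : inv_phase z (- (pi / 2)) = 0.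
Proof.
have := @cvg_smoothed_density0 z (- (pi / 2)).
rewrite cosN cos_pihalf; under eq_fun do rewrite mulr0.
by move=> c; apply: (cvg_unique _ c) => //; exact: cvg_cst.
Qed.

Lemma inv_phase_ge0 z : 0 <= inv_phase z 0.
Proof.
apply: (cvgr_to_ge (@cvg_smoothed_density0 z 0)); apply: nearW => n.
by rewrite cos0 mulr1 smoothed_density_ge0//; exact: harmonic_gt0.
Qed.

Lemma measurable_smoothed_density s : 0 < s ->
  measurable_fun setT (smoothed_density s).
Proof.
move=> s0; apply: measurable_funM => //.
have -> : smoothed_mean X s = (fun z => fine (fubini_F P (fun p : 'rV[R]_d * T =>
    (\prod_(i < d) cauchy s (X p.2 ord0 i - p.1 ord0 i))%:E) z)) by [].
apply: (measurableT_comp (@fine_measurable _ _ measurableT)).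
apply: measurable_fun_fubini_tonelli_F.
  apply/measurable_EFinP/measurable_prod => i _; apply: measurable_cauchy => //.
  apply: measurable_funB.
    exact: measurableT_comp (measurableT_comp (measurable_coor i) (measurable_rv X)) measurable_snd.
  exact: measurableT_comp (measurable_coor i) measurable_fst.
move=> p; rewrite lee_fin.
by have /andP[] := cauchy_prod_bound (fun i => X p.2 ord0 i - p.1 ord0 i) s0.
Qed.

Lemma measurable_inv_phase0 : measurable_fun setT (inv_phase ^~ 0).
Proof.
apply: (@measurable_fun_cvg _ _ _ _ (fun n z => smoothed_density (harmonic n) z)).
  by move=> n; apply: measurable_smoothed_density; exact: harmonic_gt0.
move=> z _; have := @cvg_smoothed_density0 z 0.
by rewrite cos0; under eq_fun do rewrite mulr1.
Qed.

Lemma inverse_fourierE z : (inv_phase z 0)%:C%C = inverse_fourier (charfun X) z.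
Proof.
have reE u : complex.Re (expi (- dotr u z) * charfun X u) = phase X u (0 - dotr u z).
  by rewrite phaseE sub0r; case: (charfun X u).
(* An imaginary part is the real part after multiplication by e^{-i pi/2}. *)
have imE u : complex.Im (expi (- dotr u z) * charfun X u) =
    phase X u (- (pi / 2) - dotr u z).
  rewrite phaseE [- (pi / 2) - _]addrC cosBpihalf sinBpihalf.
  by case: (charfun X u) => a b /=; ring.
rewrite /inverse_fourier /cintegral.
rewrite (eq_Rintegral _ (fun u _ => reE u)) (eq_Rintegral _ (fun u _ => imE u)).
apply/eqP; rewrite eq_complex /= !mul0r subr0 addr0 eqxx/=.
by rewrite -/(inv_phase z (- (pi / 2))) inv_phaseNpihalf.
Qed.

End inversion.

(** * Half-open boxes and the identification of the density *)

Section boxes.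
Context {R : realType} {d : nat}.
Implicit Types (a b : 'I_d -> R).

Definition box a b : set 'rV[R]_d := [set x | forall i, a i < x ord0 i <= b i].

Lemma measurable_box a b : measurable (box a b).
Proof.
rewrite (_ : box a b = \bigcap_(i in [set: 'I_d])
    (fun x : 'rV[R]_d => x ord0 i) @^-1` `]a i, b i]%classic).
  apply: fin_bigcap_measurable => // i _.
  by rewrite -[X in measurable X]setTI; exact: measurable_coor.
apply/seteqP; split=> x /= H i; first by move=> _; rewrite /= in_itv; exact: H.
by move: (H i Logic.I); rewrite /= ?in_itv.
Qed.

Lemma measurable_closed_box a b :
  measurable [set x : 'rV[R]_d | forall i, a i <= x ord0 i <= b i].
Proof.
rewrite (_ : mkset _ = \bigcap_(i in [set: 'I_d])
    (fun x : 'rV[R]_d => x ord0 i) @^-1` `[a i, b i]%classic).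
  apply: fin_bigcap_measurable => // i _.
  by rewrite -[X in measurable X]setTI; exact: measurable_coor.
apply/seteqP; split=> x /= H i; first by move=> _; rewrite /= in_itv; exact: H.
by move: (H i Logic.I); rewrite /= ?in_itv.
Qed.

Lemma lebesgue_row_box_lty a b : (forall i, a i <= b i) ->
  (lebesgue_row d (box a b) < +oo)%E.
Proof.
move=> ab; rewrite (le_lt_trans _ (ltry (\prod_(i < d) (b i - a i))))//.
rewrite -lebesgue_row_box//; apply: le_measure; rewrite ?inE.
- exact: measurable_box.
- exact: measurable_closed_box.
- by move=> x Hx i; have /andP[/ltW-> ->] := Hx i.
Qed.

Lemma indic_box a b x : \1_(box a b) x = \prod_(i < d) \1_(`]a i, b i]) (x ord0 i) :> R.
Proof.
rewrite indicE; have [/set_mem H|/negP H] := boolP (x \in box a b).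
  by rewrite big1// => i _; rewrite indicE mem_set//= in_itv/= H.
have /existsNP[i Hi] : ~ box a b x by move=> /mem_set.
by rewrite (bigD1 i)//= indicE memNset ?mul0r//= in_itv/= => /Hi.
Qed.

End boxes.

Section atan_step.
Context {R : realType}.
Implicit Types (a b c x : R) (n : nat).

(* The shift by harmonic n dominates the scale (harmonic n)^2, so that in the limit
   intervals become closed on the right and open on the left. *)
Definition atan_step c x n : R :=
  atan ((c - (x - harmonic n)) / (harmonic n) ^+ 2).

(** The argument of atan equals (n+1) ((c - x) (n+1) + 1). At x = c it is n+1, which still tends to
    infinity; without the shift it would stay at 0, and a face of a box would count for one half. *)
Lemma cvg_atan_step c x :
  atan_step c x n @[n --> \oo] --> (if x <= c then pi / 2 else - (pi / 2)).
Proof.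
have E n : (c - (x - harmonic n)) / (harmonic n) ^+ 2 =
    n.+1%:R * ((c - x) * n.+1%:R + 1).
  by rewrite /=; field; rewrite addrC natr1 pnatr_eq0.
have cn : (n.+1%:R : R) @[n --> \oo] --> +oo.
  rewrite (cvg_shiftS (fun n => n%:R : R) (pinfty_nbhs R)); exact: cvgr_idn.
rewrite /atan_step; under eq_fun do rewrite E.
case: ifPn => [xc|]; last rewrite -ltNge => cx.
  apply: (cvg_comp _ _ _ (@cvgy_atan R)).
  apply: (ger_cvgy _ cn); apply: nearW => n.
  by rewrite ler_peMr// lerDr mulr_ge0// subr_ge0.
have cN : - (n.+1%:R * ((c - x) * n.+1%:R + 1)) @[n --> \oo] --> +oo.
  have xc0 : 0 < x - c by rewrite subr_gt0.
  have : n.+1%:R * ((x - c) * n.+1%:R - 1) @[n --> \oo] --> +oo.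
    apply: (ger_cvgy _ cn); near=> n; rewrite ler_peMr// lerBrDr mulrC -ler_pdivrMr//.
    by near: n; exact: cvgry_ge cn _.
  rewrite [X in X @ _](_ : _ = (fun n => - (n.+1%:R * ((c - x) * n.+1%:R + 1)))) //.
  by apply/funext => n; ring.
under eq_fun do rewrite -[_ * _]opprK atanN.
apply: cvgN; exact: (cvg_comp _ _ cN (@cvgy_atan R)).
Unshelve. all: by end_near. Qed.

Lemma cvg_atan_indic a b x : a <= b ->
  pi^-1 * (atan_step b x n - atan_step a x n) @[n --> \oo] --> (\1_(`]a, b]) x : R).
Proof.
move=> ab.
have -> : \1_(`]a, b]) x = pi^-1 * ((if x <= b then pi / 2 else - (pi / 2)) -
   (if x <= a then pi / 2 else - (pi / 2))) :> R.
  rewrite indicE /=; have := @pi_gt0 R; move: (pi : R) => p p0.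
  have [xa|ax] := leP x a.
    by rewrite (le_trans xa ab) subrr mulr0 memNset//= in_itv/= ltNge xa.
  have [xb|bx] := leP x b.
    by rewrite mem_set /= ?in_itv/= ?ax//; field; rewrite gt_eqF.
  by rewrite subrr mulr0 memNset//= in_itv/= ax leNgt bx.
apply: cvgM; first exact: cvg_cst.
by apply: cvgB; exact: cvg_atan_step.
Qed.

Lemma atan_step_bound a b x n : a <= b ->
  0 <= pi^-1 * (atan_step b x n - atan_step a x n) <= 1.
Proof.
move=> ab; have p0 := @pi_gt0 R.
have la : atan_step a x n <= atan_step b x n.
  by apply: le_atan; rewrite ler_wpM2r ?invr_ge0 ?sqr_ge0// lerB.
rewrite mulr_ge0 ?invr_ge0 ?pi_ge0 ?subr_ge0//= mulrC ler_pdivrMr// mul1r.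
have := atan_ltpi2 ((b - (x - harmonic n)) / (harmonic n) ^+ 2).
have := atan_gtNpi2 ((a - (x - harmonic n)) / (harmonic n) ^+ 2).
rewrite -!/(atan_step _ _ _) => h1 h2.
rewrite [leRHS]splitr; apply: lerD; first exact: ltW.
by rewrite lerNl; exact: ltW.
Qed.

End atan_step.

Section box_probability.
Context {R : realType} {d : nat} {disp : measure_display} {T : measurableType disp}.
Context (P : probability T R) (X : {RV P >-> 'rV[R]_d}).
Local Notation nphi u := (ComplexField.Normc.normc (charfun X u)).
Context (iphi : (lebesgue_row d).-integrable setT (fun u => (nphi u)%:E)).
Context (a b : 'I_d -> R) (ab : forall i, a i < b i).

Let s n : R := (harmonic n) ^+ 2.

Let s_gt0 n : 0 < s n.
Proof. by rewrite exprn_gt0// harmonic_gt0. Qed.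

(** The probability that X w, shifted by - [harmonic n] in each coordinate and perturbed by
    independent Cauchy noise of scale [s n], falls in the box. *)
Let step n (w : T) : R := \prod_(i < d)
  (pi^-1 * (atan_step (b i) (X w ord0 i) n - atan_step (a i) (X w ord0 i) n)).

Let cvg_step w : step n w @[n --> \oo] --> (\1_(box a b) (X w) : R).
Proof.
by rewrite indic_box; apply: cvg_bigprod => i; apply: cvg_atan_indic; exact: ltW.
Qed.

Let step_bound n w : 0 <= step n w <= 1.
Proof.
have h i := atan_step_bound (X w ord0 i) n (ltW (ab i)).
rewrite prodr_ge0/=; last by move=> i _; have /andP[] := h i.
by apply: prodr_ile1 => i _; exact: h.
Qed.

(** Integrating out z gives [step]; integrating out w gives the smoothed density at the shifted
    point, restricted to the box. Tonelli equates the two in [step_mean]. *)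
Let kernel n (p : T * 'rV[R]_d) : R := \prod_(i < d)
  (pi^-1 * cauchy (s n) (X p.1 ord0 i - (p.2 + const_mx (harmonic n)) ord0 i) *
   \1_(`]a i, b i]) (p.2 ord0 i)).

Let kernel_ge0 n p : 0 <= kernel n p.
Proof.
apply: prodr_ge0 => i _.
apply: mulr_ge0; last by rewrite indicE ler0n.
apply: mulr_ge0; [by rewrite invr_ge0 pi_ge0|exact: cauchy_ge0].
Qed.

Let measurable_kernel n : measurable_fun setT (EFin \o kernel n).
Proof.
apply/measurable_EFinP/measurable_prod => i _; apply: measurable_funM.
  apply: measurable_funM => //; apply: measurable_cauchy => //.
  apply: measurable_funB.
    exact: measurableT_comp (measurableT_comp (measurable_coor i) (measurable_rv X)) measurable_fst.
  under eq_fun do rewrite !mxE.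
  apply: measurable_funD => //; exact: measurableT_comp (measurable_coor i) measurable_snd.
apply: (@measurableT_comp _ _ _ _ _ _ (\1_(`]a i, b i]) : R -> R)) => //.
exact: measurableT_comp (measurable_coor i) measurable_snd.
Qed.

Let kernel_row n w : (\int[lebesgue_row d]_z (kernel n (w, z))%:E = (step n w)%:E)%E.
Proof.
pose g (i : 'I_d) (x : R) : R :=
  pi^-1 * cauchy (s n) (X w ord0 i - harmonic n - x) * \1_(`]a i, b i]) x.
rewrite (eq_integral (fun z : 'rV[R]_d => (\prod_(i < d) g i (z ord0 i))%:E)); last first.
  move=> z _; rewrite /kernel; congr _%:E; apply: eq_bigr => i _.
  by rewrite /g !mxE/= opprD [- _ - _]addrC addrA.
apply: prod_row_integral => [i|i x|i].
- apply: measurable_funM => //; apply: measurable_funM => //.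
  by apply: measurable_cauchy => //; exact: measurable_funB.
- apply: mulr_ge0; last by rewrite indicE ler0n.
  apply: mulr_ge0; [by rewrite invr_ge0 pi_ge0|exact: cauchy_ge0].
- rewrite /atan_step -(cauchy_box _ (s_gt0 n) (ab i)) -integral_itv_obnd_cbnd; last first.
    apply/measurable_EFinP/measurable_funTS; apply: measurable_funM => //.
    by apply: measurable_cauchy => //; exact: measurable_funB.
  rewrite [RHS]integral_mkcond; apply: eq_integral => x _.
  by rewrite patchE /g indicE; case: ifPn => _; rewrite ?mulr1 ?mulr0.
Qed.

Let kernel_mean n z : (\int[P]_w (kernel n (w, z))%:E =
  (smoothed_density X (s n) (z + const_mx (harmonic n)) * \1_(box a b) z)%:E)%E.
Proof.
pose c w := \prod_(i < d) cauchy (s n) (X w ord0 i - (z + const_mx (harmonic n)) ord0 i).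
have kE w : kernel n (w, z) = pi ^- d * \1_(box a b) z * c w.
  rewrite /kernel big_split/= big_split/= indic_box prodr_const card_ord exprVn.
  by rewrite -!mulrA; congr (_ * _); rewrite mulrC.
have ic : P.-integrable setT (EFin \o c) by exact: integrable_cauchy_prod.
rewrite /smoothed_density /smoothed_mean mulrAC -RintegralZl// /Rintegral fineK.
  by apply: eq_integral => w _; rewrite kE.
by apply: integrable_fin_num => //; exact: integrable_scale.
Qed.

Let M : R := (2 * pi) ^- d * \int[lebesgue_row d]_u nphi u.

Let density_le z : inv_phase X z 0 <= M.
Proof.
apply: (cvgr_to_le (@cvg_smoothed_density _ _ _ _ _ _ iphi harmonic (fun=> 0) z 0
  (@harmonic_gt0 R) (@cvg_harmonic R) (@cvg_cst _ _ _ _ _))).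
by apply: nearW => n; rewrite cos0 mulr1; apply: smoothed_density_le => //; exact: harmonic_gt0.
Qed.

Let box_lty := lebesgue_row_box_lty (fun i => ltW (ab i)).

Let integrable_box (f : 'rV[R]_d -> R) : measurable_fun (box a b) f ->
  (forall z, 0 <= f z <= M) -> (lebesgue_row d).-integrable (box a b) (EFin \o f).
Proof.
move=> mf fM; apply: measurable_bounded_integrable => //; first exact: measurable_box.
exists M; split; first exact: num_real.
move=> x Mx z _; have /andP[f0 f1] := fM z.
by rewrite /= ger0_norm// (le_trans f1)// ltW.
Qed.

Let step_mean n : \int[P]_w step n w =
  \int[lebesgue_row d]_(z in box a b)
    smoothed_density X (s n) (z + const_mx (harmonic n)).
Proof.
have := fubini_tonelli (m1 := P) (m2 := lebesgue_row d) (EFin \o kernel n)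
  (measurable_kernel n) (fun p => kernel_ge0 n p).
rewrite /= (eq_integral _ _ (fun w _ => kernel_row n w)).
rewrite (eq_integral _ _ (fun z _ => kernel_mean n z)) /Rintegral => ->.
congr fine; rewrite [RHS]integral_mkcond; apply: eq_integral => z _.
by rewrite patchE indicE; case: ifPn => _; rewrite ?mulr1 ?mulr0.
Qed.

(** Two limits of the same sequence. Under P, [step n] tends to the indicator of the box and is
    dominated by 1; under Lebesgue measure, the smoothed densities tend to the inverse transform and
    are dominated by [M] on a box of finite volume. *)
Lemma box_probability :
  (distribution P X (box a b) = \int[lebesgue_row d]_(z in box a b) (inv_phase X z 0)%:E)%E.
Proof.
have mbox := measurable_box a b.
have mX : measurable (X @^-1` box a b).
  by rewrite -[X in measurable X]setTI; exact: measurable_rv.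
have cl : \int[P]_w step n w @[n --> \oo] --> \int[P]_w \1_(X @^-1` box a b) w.
  apply: (@dominated_Rintegral _ _ _ _ _ _ _ (cst 1)) => //.
  - move=> n; apply: measurable_prod => i _; apply: measurable_funM => //.
    have mc c : measurable_fun setT (fun w => atan_step c (X w ord0 i) n).
      apply: (@measurableT_comp _ _ _ _ _ _ (atan : R -> R)).
        by apply: continuous_measurable_fun; exact: continuous_atan.
      apply: measurable_funM => //; do 2 apply: measurable_funB => //.
      exact: measurableT_comp (measurable_coor i) (measurable_rv X).
    exact: measurable_funB.
  - exact: finite_measure_integrable_cst.
  - by move=> n w _; have /andP[s0 s1] := step_bound n w; rewrite ger0_norm.
have cr : \int[P]_w step n w @[n --> \oo] -->
    \int[lebesgue_row d]_(z in box a b) inv_phase X z 0.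
  under eq_fun do rewrite step_mean.
  apply: (@dominated_Rintegral _ _ _ _ _ _ _ (cst M)) => //.
  - move=> n; apply: measurable_funTS.
    apply: (measurableT_comp (measurable_smoothed_density X (s_gt0 n))).
    apply/measurable_fun_coorP => i; under eq_fun do rewrite !mxE.
    by apply: measurable_funD => //; exact: measurable_coor.
  - by apply: measurable_funTS; exact: measurable_inv_phase0.
  - move=> z _.
    have s_to0 : s n @[n --> \oo] --> 0.
      by rewrite -(mulr0 0); under eq_fun do rewrite /s expr2; apply: cvgM; exact: cvg_harmonic.
    have := @cvg_smoothed_density _ _ _ _ _ _ iphi s harmonic z 0 s_gt0 s_to0 (@cvg_harmonic R).
    by rewrite cos0; under eq_fun do rewrite mulr1.
  - apply: integrable_box => // z; rewrite lexx andbT.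
    by rewrite (le_trans (inv_phase_ge0 iphi z)).
  - by move=> n z _; rewrite ger0_norm ?smoothed_density_ge0//; exact: smoothed_density_le.
have E := cvg_unique (@Rhausdorff R) cl cr.
rewrite -[RHS]fineK; last first.
  apply: integrable_fin_num => //; apply: integrable_box => [|z].
    by apply: measurable_funTS; exact: measurable_inv_phase0.
  by rewrite (inv_phase_ge0 iphi) density_le.
rewrite -[fine _]/(\int[lebesgue_row d]_(z in box a b) inv_phase X z 0) -E.
rewrite /Rintegral integral_indic// setIT fineK//.
exact: fin_num_measure.
Qed.

End box_probability.

Definition density_measure {disp} {T : measurableType disp} {R : realType}
    (mu : {measure set T -> \bar R}) (f : T -> \bar R)
    (mf : measurable_fun setT f) (f0 : forall x, (0 <= f x)%E) :
    {measure set T -> \bar R} :=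
  HB.pack (fun A => \int[mu]_(x in A) f x)%E
    (isMeasure.Build _ _ _ (fun A => \int[mu]_(x in A) f x)%E
      (integral_set0 mu f) (fun A => @integral_ge0 _ _ _ mu A f (fun x _ => f0 x))
      (semi_sigma_additive_nng_induced mf f0)).

Section density.
Context {R : realType} {d : nat}.

Lemma row_lt_bound (x : 'rV[R]_d) :
  exists k : nat, forall i, `|x ord0 i| < k.+1%:R.
Proof.
exists (Num.trunc (\sum_(i < d) `|x ord0 i|)) => i.
apply: (le_lt_trans _ (truncnS_gt _)).
by rewrite (bigD1 i)//= lerDl sumr_ge0.
Qed.

Definition boxes : set (set 'rV[R]_d) := [set A | exists a b, A = box a b].

(** For the nontrivial inclusion, the identity out of the space carrying the box sigma-algebra is
    measurable once its coordinates are, and a half-space c < x_i is a countable union of boxes. *)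
Lemma measurable_boxes : measurable = <<s boxes >>.
Proof.
apply/seteqP; split; last first.
  apply: smallest_sub; first exact: sigma_algebra_measurable.
  by move=> _ [a [b ->]]; exact: measurable_box.
pose id' : g_sigma_algebraType boxes -> 'rV[R]_d := id.
suff mid : measurable_fun setT id'.
  move=> A mA; have := mid measurableT A mA; rewrite setTI; exact.
apply/measurable_fun_coorP => i.
apply: (measurability (@RGenOInfty.G R)); first exact: RGenOInfty.measurableE.
move=> _ [_ [c ->] <-]; rewrite setTI.
rewrite (_ : _ @^-1` _ = \bigcup_k box (fun j => if j == i then c else - k.+1%:R)
    (fun=> k.+1%:R)).
  by apply: bigcup_measurable => k _; apply: sub_sigma_algebra; do 2 eexists.
apply/seteqP; split => x /=.
  rewrite in_itv/= andbT => cx; have [k xk] := row_lt_bound x.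
  exists k => // j; have := xk j; rewrite ltr_norml => /andP[h1 h2].
  by rewrite (ltW h2) andbT; case: eqP => [->|].
by move=> [k _ /(_ i)]; rewrite eqxx in_itv/= andbT => /andP[].
Qed.

Lemma boxes_setI : setI_closed boxes.
Proof.
move=> _ _ [a [b ->]] [a' [b' ->]].
exists (fun i => Num.max (a i) (a' i)), (fun i => Num.min (b i) (b' i)).
apply/seteqP; split => x /=.
  move=> [h h'] i; have /andP[h1 h2] := h i; have /andP[h3 h4] := h' i.
  by rewrite gt_max le_min h1 h2 h3 h4.
move=> h; split=> i; have := h i; rewrite gt_max le_min.
  by move=> /andP[/andP[-> _] /andP[-> _]].
by move=> /andP[/andP[_ ->] /andP[_ ->]].
Qed.

Lemma bigcup_boxes :
  \bigcup_k box (fun=> - k.+1%:R) (fun=> k.+1%:R) = [set: 'rV[R]_d].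
Proof.
apply/seteqP; split => // x _; have [k xk] := row_lt_bound x.
by exists k => // i; have := xk i; rewrite ltr_norml => /andP[-> /ltW].
Qed.

Context {disp : measure_display} {T : measurableType disp}.
Context (P : probability T R) (X : {RV P >-> 'rV[R]_d}).
Local Notation nphi u := (ComplexField.Normc.normc (charfun X u)).

(** Uniqueness of measures on a generating class stable under intersection: the law of X and the
    measure with density f agree on boxes, and the exhausting boxes have finite probability. *)
Lemma is_density_inv_phase :
  (lebesgue_row d).-integrable setT (fun u => (nphi u)%:E) ->
  is_density X (inv_phase X ^~ 0).
Proof.
move=> iphi; have mf := measurable_inv_phase0 iphi; have f0 := inv_phase_ge0 iphi.
split => // A mA.
have mfE : measurable_fun setT (EFin \o (inv_phase X ^~ 0)) by exact/measurable_EFinP.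
pose nu := density_measure (lebesgue_row d) mfE (fun z => f0 z).
apply: (@measure_unique _ _ _ boxes (fun k => box (fun=> - k.+1%:R) (fun=> k.+1%:R))
   measurable_boxes boxes_setI _ bigcup_boxes (distribution P X) nu) => //.
- by move=> k; exists (fun=> - k.+1%:R), (fun=> k.+1%:R).
- move=> _ [a [b ->]].
  have [ab|/existsNP[i abi]] := pselect (forall i, a i < b i).
    exact: box_probability.
  rewrite (_ : box a b = set0) ?measure0//; apply/seteqP; split => // x /= /(_ i).
  by move=> /andP[ax xb]; apply: abi; exact: lt_le_trans xb.
- by move=> k; rewrite -ge0_fin_numE//; apply: fin_num_measure; exact: measurable_box.
Qed.

End density.

(** * The Fortet-Mourier class *)

Section euclidean_norm.
Context {R : realType} {d : nat}.
Implicit Types (u x : 'rV[R]_d).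

Lemma enorm_ge0 u : 0 <= enorm u.
Proof. exact: sqrtr_ge0. Qed.

Lemma enormZ (c : R) u : enorm (c *: u) = `|c| * enorm u.
Proof.
rewrite /enorm (_ : dotr _ _ = c ^+ 2 * dotr u u).
  by rewrite sqrtrM ?sqr_ge0// sqrtr_sqr.
by rewrite /dotr mulr_sumr; apply: eq_bigr => i _; rewrite !mxE; ring.
Qed.

Lemma coord_le_enorm x i : `|x ord0 i| <= enorm x.
Proof.
rewrite -sqrtr_sqr ler_wsqrtr// /dotr (bigD1 i)//= -expr2 lerDl.
by apply: sumr_ge0 => j _; rewrite -expr2 sqr_ge0.
Qed.

(** Coordinatewise, |x|^2 <= d A^2; then d <= d^2 removes the square root from the constant. *)
Lemma enorm_le_box (A : R) x : 0 <= A -> (forall i, - A <= x ord0 i <= A) ->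
  enorm x <= d%:R * A.
Proof.
move=> A0 xA; rewrite -[leRHS]ger0_norm ?mulr_ge0// -sqrtr_sqr ler_wsqrtr//.
have le1 : dotr x x <= d%:R * A ^+ 2.
  rewrite /dotr -[d in leRHS]card_ord -sumr_const mulr_suml; apply: ler_sum => i _.
  by rewrite mul1r; have /andP[] := xA i; nra.
apply: le_trans le1 _; rewrite exprMn ler_wpM2r ?sqr_ge0// expr2 -natrM ler_nat.
by case: (d) => // n; rewrite leq_pmulr.
Qed.

End euclidean_norm.

Section test_function.
Context {R : realType} {d : nat}.
Implicit Types (u x : 'rV[R]_d) (t : R).

Lemma continuous_dotr u : continuous (dotr u : 'rV[R]_d -> R).
Proof.
move=> x; apply: differentiable_continuous.
have -> : dotr u = \sum_(i < d) (u ord0 i *: (fun y : 'rV[R]_d => y ord0 i : R)).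
  by apply/funext => y; rewrite fct_sumE; apply: eq_bigr.
by apply: differentiable_sum => i; apply: differentiableZ; exact: differentiable_coord.
Qed.

Definition wave u t x : R := (1 + enorm u)^-1 * cos (dotr u x + t).

Lemma is_diff_dotr u x : is_diff x (dotr u : 'rV[R]_d -> R) (dotr u).
Proof.
have lin : linear (dotr u : 'rV[R]_d -> R).
  move=> k v w; rewrite /dotr /GRing.scale/= mulr_sumr -big_split.
  by apply: eq_bigr => i _; rewrite !mxE/=; ring.
pose f : {linear 'rV[R]_d -> R} := HB.pack (dotr u : 'rV[R]_d -> R)
  (GRing.isLinear.Build _ _ _ _ _ lin).
apply: DiffDef.
  exact: (@linear_differentiable _ _ _ f x (@continuous_dotr u)).
exact: (@diff_lin _ _ _ f x (@continuous_dotr u)).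
Qed.

Lemma differentiable_wave u t x : differentiable (wave u t) x /\
  'd (wave u t) x = (fun v => - (1 + enorm u)^-1 * sin (dotr u x + t) * dotr u v) :> (_ -> _).
Proof.
pose f (y : R) : R := (1 + enorm u)^-1 * cos (y + t).
have df (y : R) : is_derive y 1 f (- (1 + enorm u)^-1 * sin (y + t)).
  by rewrite /f; apply: is_derive_eq; rewrite /GRing.scale/=; ring.
have dff y : differentiable f y by apply/derivable1_diffP; apply: ex_derive; exact: df.
have du := is_diff_dotr u x.
have -> : wave u t = f \o dotr u by [].
split; first by apply: differentiable_comp.
rewrite diff_comp//; apply/funext => v /=.
have dfx := df (dotr u x).
rewrite diff1E// derive1E derive_val diff_val /GRing.scale/= mulrC.
by [].
Qed.

Lemma gradient_wave u t x :
  gradient (wave u t) x = (- (1 + enorm u)^-1 * sin (dotr u x + t)) *: u.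
Proof.
apply/rowP => i; rewrite !mxE; have [df E] := differentiable_wave u t x.
rewrite deriveE// E; congr (_ * _); rewrite /dotr (bigD1 i)//= big1 ?addr0.
  by rewrite mxE !eqxx mulr1.
by move=> j ji; rewrite mxE (negbTE ji) andbF mulr0.
Qed.

(** The function is at most (1 + |u|)^-1 and its gradient at most |u| (1 + |u|)^-1; the
    normalisation makes these two bounds add up to exactly 1. *)
Lemma fm_class_wave u t : fm_class (wave u t).
Proof.
have e0 : 0 < 1 + enorm u by rewrite ltr_pwDl// enorm_ge0.
have c0 : 0 <= (1 + enorm u)^-1 by rewrite invr_ge0 ltW.
split; first split.
- by move=> x; have [] := differentiable_wave u t x.
- pose h (y : R) : 'rV[R]_d := (- (1 + enorm u)^-1 * sin (y + t)) *: u.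
  have -> : gradient (wave u t) = h \o dotr u.
    by apply/funext => x; exact: gradient_wave.
  have ch : continuous h.
    move=> y; apply: cvgZr_tmp; apply: cvgM; first exact: cvg_cst.
    apply: continuous_cvg; first exact: continuous_sin.
    by apply: cvgD; [exact: cvg_id|exact: cvg_cst].
  by move=> x; apply: continuous_comp; [exact: continuous_dotr|exact: ch].
- apply: (@le_trans _ _ (((1 + enorm u)^-1)%:E + ((1 + enorm u)^-1 * enorm u)%:E)%E).
    apply: leeD; apply: ub_ereal_sup => _ [x _ <-]; rewrite lee_fin.
      by rewrite /wave normrM (ger0_norm c0) ler_piMr// norm_cos_le1.
    rewrite gradient_wave enormZ ler_wpM2r ?enorm_ge0//.
    by rewrite normrM normrN (ger0_norm c0) ler_piMr// norm_sin_le1.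
  by rewrite -EFinD lee_fin -{1}[_^-1]mulr1 -mulrDr mulVf// gt_eqF.
Qed.

End test_function.

Section phase_distance.
Context {R : realType} {d : nat} {d1 d2 : measure_display}.
Context {T1 : measurableType d1} {T2 : measurableType d2}.
Context (P1 : probability T1 R) (P2 : probability T2 R).
Context (X1 : {RV P1 >-> 'rV[R]_d}) (X2 : {RV P2 >-> 'rV[R]_d}).

Lemma expectation_wave {disp} {T : measurableType disp} (P : probability T R)
    (X : {RV P >-> 'rV[R]_d}) u t :
  ('E_P[wave u t \o X] = ((1 + enorm u)^-1 * phase X u t)%:E)%E.
Proof.
have ic := integrable_cos_rv X u t.
rewrite unlock /phase -RintegralZl// /Rintegral fineK//.
by apply: integrable_fin_num => //; exact: integrable_scale.
Qed.

Lemma phase_distance (eps : R) u t : dFM X1 X2 = eps%:E ->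
  `|phase X1 u t - phase X2 u t| <= (1 + enorm u) * eps.
Proof.
move=> dE; have e0 : 0 < 1 + enorm u by rewrite ltr_pwDl// enorm_ge0.
rewrite -ler_pdivrMl// -lee_fin -dE.
have -> : ((1 + enorm u)^-1 * `|phase X1 u t - phase X2 u t|)%:E =
    `|'E_P1[wave u t \o X1] - 'E_P2[wave u t \o X2]|%E.
  by rewrite !expectation_wave -EFinB -mulrBr abse_EFin normrM ger0_norm// invr_ge0 ltW.
by apply: ereal_sup_ubound; exists (wave u t) => //; exact: fm_class_wave.
Qed.

Lemma dFM_ge0 : (0 <= dFM X1 X2)%E.
Proof.
apply: (@le_trans _ _ `|'E_P1[wave 0 0 \o X1] - 'E_P2[wave 0 0 \o X2]|%E) => //.
by apply: ereal_sup_ubound; exists (wave 0 0) => //; exact: fm_class_wave.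
Qed.

End phase_distance.

(** * Bounds with a cutoff *)

Section cube.
Context {R : realType} {d : nat}.

(** A cube serves in place of a Euclidean ball because its volume is explicit; |x| <= d A inside and
    |x| >= A outside are all that the cutoff uses. *)
Definition cube (A : R) : set 'rV[R]_d := [set x | forall i, - A <= x ord0 i <= A].

Lemma measurable_cube A : measurable (cube A).
Proof. exact: (measurable_closed_box (fun=> - A) (fun=> A)). Qed.

Lemma lebesgue_row_cube A : 0 <= A -> lebesgue_row d (cube A) = ((2 * A) ^+ d)%:E.
Proof.
move=> A0; rewrite (@lebesgue_row_box _ _ (fun=> - A) (fun=> A)); last first.
  by move=> _; rewrite (le_trans _ A0)// oppr_le0.
by rewrite prodr_const card_ord opprK -mulr2n mulr_natl.
Qed.

Lemma le_enorm_setC_cube A x : ~ cube A x -> A <= enorm x.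
Proof.
move=> /existsNP[i /negP]; rewrite -ler_norml -ltNge => /ltW Ax.
exact: le_trans Ax (coord_le_enorm x i).
Qed.

End cube.

Section exponential_moments.
Context {R : realType} {d : nat} {disp : measure_display} {T : measurableType disp}.
Context (P : probability T R) (X : {RV P >-> 'rV[R]_d}) (r C A : R).
Context (r0 : 0 < r).

(** Markov's inequality: outside the cube, 1 <= e^{-rA} e^{r|x|}. *)
Lemma tail_probability : ('E_P[fun w => expR (r * enorm (X w))] <= C%:E)%E ->
  (distribution P X (~` cube A) <= (C * expR (- (r * A)))%:E)%E.
Proof.
move=> EX; have mQ : measurable (~` cube A : set 'rV[R]_d).
  by apply: measurableC; exact: measurable_cube.
rewrite -[X in (X <= _)%E]mul1e.
have -> : (1 * distribution P X (~` cube A) =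
    \int[distribution P X]_(x in ~` cube A) cst 1 x)%E by rewrite integral_cst.
apply: (@le_trans _ _ (\int[distribution P X]_x
    (expR (- (r * A)) * expR (r * enorm x))%:E)%E).
  have me : measurable_fun setT (fun x : 'rV[R]_d => (expR (- (r * A)) * expR (r * enorm x))%:E).
    apply/measurable_EFinP/measurable_funM => //.
    apply: (@measurableT_comp _ _ _ _ _ _ (expR : R -> R)) => //.
    by apply: measurable_funM => //; exact: measurable_enorm.
  apply: (@le_trans _ _ (\int[distribution P X]_(x in ~` cube A)
    (expR (- (r * A)) * expR (r * enorm x))%:E)%E).
    apply: ge0_le_integral => //.
    - exact: measurable_funTS.
    - move=> x /le_enorm_setC_cube xA; rewrite lee_fin -expRD -expR0 ler_expR.
      by rewrite addrC subr_ge0 ler_pM2l.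
  apply: ge0_subset_integral => //.
rewrite ge0_integral_distribution; first last.
- by move=> x; rewrite lee_fin mulr_ge0 ?expR_ge0.
- apply/measurable_EFinP/measurable_funM => //.
  apply: (@measurableT_comp _ _ _ _ _ _ (expR : R -> R)) => //.
  by apply: measurable_funM => //; exact: measurable_enorm.
rewrite /=; under eq_integral do rewrite EFinM.
rewrite ge0_integralZl_EFin ?expR_ge0//; first last.
- apply/measurable_EFinP; apply: (@measurableT_comp _ _ _ _ _ _ (expR : R -> R)) => //.
  by apply: measurable_funM => //; apply: measurable_enorm; exact: measurable_rv.
rewrite [C * _]mulrC EFinM lee_wpmul2l ?lee_fin ?expR_ge0//.
by rewrite unlock in EX.
Qed.

Local Notation nphi u := (ComplexField.Normc.normc (charfun X u)).

Lemma measurable_charfun_exp : measurable_fun setT (fun u => nphi u * expR (r * enorm u)).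
Proof.
apply: measurable_funM; first exact: measurable_normc_charfun.
apply: (@measurableT_comp _ _ _ _ _ _ (expR : R -> R)) => //.
by apply: measurable_funM => //; exact: measurable_enorm.
Qed.

Lemma normc_charfun_ge0 u : 0 <= nphi u.
Proof. by rewrite normcE sqrtr_ge0. Qed.

Lemma integrable_charfun :
  (\int[lebesgue_row d]_u (nphi u * expR (r * enorm u))%:E <= C%:E)%E ->
  (lebesgue_row d).-integrable setT (fun u => (nphi u)%:E).
Proof.
move=> h; apply/integrableP; split.
  by apply/measurable_EFinP; exact: measurable_normc_charfun.
apply: le_lt_trans (ltry C); apply: le_trans h; apply: ge0_le_integral => //.
- apply: measurableT_comp => //; apply/measurable_EFinP; exact: measurable_normc_charfun.
- by apply/measurable_EFinP; exact: measurable_charfun_exp.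
- move=> u _; rewrite /abse lee_fin ger0_norm ?normc_charfun_ge0// ler_peMr ?normc_charfun_ge0//.
  by rewrite -expR0 ler_expR mulr_ge0 ?enorm_ge0// ltW.
Qed.

End exponential_moments.

Section density_difference.
Context {R : realType} {d : nat} {d1 d2 : measure_display}.
Context {T1 : measurableType d1} {T2 : measurableType d2}.
Context (P1 : probability T1 R) (P2 : probability T2 R).
Context (X1 : {RV P1 >-> 'rV[R]_d}) (X2 : {RV P2 >-> 'rV[R]_d}).
Context (r C eps : R) (r0 : 0 < r).
Context (phi1 : (\int[lebesgue_row d]_u
  (ComplexField.Normc.normc (charfun X1 u) * expR (r * enorm u))%:E <= C%:E)%E).
Context (phi2 : (\int[lebesgue_row d]_u
  (ComplexField.Normc.normc (charfun X2 u) * expR (r * enorm u))%:E <= C%:E)%E).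
Context (dE : dFM X1 X2 = eps%:E).

(** On the cube, (1 + |u|) eps with |u| <= d A, times the volume (2A)^d; outside, e^{-rA} times the
    exponential integrals of the two characteristic functions, each at most C. *)
Definition density_bound (A : R) : R := (2 * pi) ^- d *
  ((1 + d%:R * A) * eps * (2 * A) ^+ d + 2 * C * expR (- (r * A))).

Let i1 := integrable_charfun r0 phi1.
Let i2 := integrable_charfun r0 phi2.

Let phase_diff_le A z u : 0 <= A ->
  `|phase X1 u (0 - dotr u z) - phase X2 u (0 - dotr u z)| <=
  (1 + d%:R * A) * eps * \1_(cube A) u +
  (expR (- (r * A)) * (ComplexField.Normc.normc (charfun X1 u) * expR (r * enorm u)) +
   expR (- (r * A)) * (ComplexField.Normc.normc (charfun X2 u) * expR (r * enorm u))).
Proof.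
move=> A0; have eps0 : 0 <= eps by rewrite -lee_fin -dE dFM_ge0.
have n1 := normc_charfun_ge0 X1 u; have n2 := normc_charfun_ge0 X2 u.
rewrite indicE; have [/set_mem uA|/negP uA] := boolP (u \in cube A).
  rewrite mulr1 -[leLHS]addr0; apply: lerD; last first.
    by rewrite addr_ge0// !mulr_ge0// expR_ge0.
  apply: (le_trans (phase_distance _ _ dE)); rewrite ler_wpM2r// lerD2l.
  exact: enorm_le_box.
have /le_enorm_setC_cube Au : ~ cube A u by move=> /mem_set.
rewrite mulr0 [leRHS]add0r (le_trans (ler_normB _ _))//.
have e1 : 1 <= expR (- (r * A)) * expR (r * enorm u).
  by rewrite -expRD -expR0 ler_expR addrC subr_ge0 ler_pM2l.
by apply: lerD; apply: (le_trans (norm_phase _ _ _)); rewrite mulrCA ler_peMr.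
Qed.

Lemma density_diff_le A z : 0 <= A ->
  `|inv_phase X1 z 0 - inv_phase X2 z 0| <= density_bound A.
Proof.
move=> A0; have eps0 : 0 <= eps by rewrite -lee_fin -dE dFM_ge0.
have m1 := measurable_charfun_exp X1 r; have m2 := measurable_charfun_exp X2 r.
have c0 : 0 <= (2 * pi) ^- d :> R by rewrite invr_ge0 exprn_ge0// mulr_ge0// pi_ge0.
rewrite /inv_phase -mulrBr normrM ger0_norm// ler_wpM2l//.
have ip1 := integrable_phase i1 z 0; have ip2 := integrable_phase i2 z 0.
rewrite -RintegralB//.
have iD : (lebesgue_row d).-integrable setT
    (EFin \o (fun u => phase X1 u (0 - dotr u z) - phase X2 u (0 - dotr u z))).
  exact: eq_integrable (integrableB measurableT ip1 ip2).
rewrite -lee_fin EFin_normr_Rintegral//.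
apply: (le_trans (le_abse_integral _ _ _)) => //; first by case/integrableP: iD.
have mQ := @measurable_cube R d A.
have mi : measurable_fun setT (fun u : 'rV[R]_d => ((1 + d%:R * A) * eps * \1_(cube A) u)%:E).
  by apply/measurable_EFinP; apply: measurable_funM.
have k0 : 0 <= (1 + d%:R * A) * eps by rewrite mulr_ge0// addr_ge0// mulr_ge0.
apply: (@le_trans _ _ (\int[lebesgue_row d]_u
  (((1 + d%:R * A) * eps * \1_(cube A) u)%:E +
  ((expR (- (r * A)) * (ComplexField.Normc.normc (charfun X1 u) * expR (r * enorm u)))%:E +
   (expR (- (r * A)) * (ComplexField.Normc.normc (charfun X2 u) * expR (r * enorm u)))%:E)))%E).
  apply: ge0_le_integral => //.
  - by apply: measurableT_comp => //; by case/integrableP: iD.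
  - by apply: emeasurable_funD => //; apply: emeasurable_funD;
      apply/measurable_EFinP; apply: measurable_funM.
  - by move=> u _; rewrite -!EFinD abse_EFin lee_fin; exact: phase_diff_le.
have g0 (y : R) u : 0 <= y -> (0 <= (expR (- (r * A)) * (y * expR (r * enorm u)))%:E)%E.
  by move=> y0; rewrite lee_fin !mulr_ge0// expR_ge0.
have n1 u := normc_charfun_ge0 X1 u; have n2 u := normc_charfun_ge0 X2 u.
rewrite ge0_integralD//; first last.
- by apply: emeasurable_funD; apply/measurable_EFinP; apply: measurable_funM.
- by move=> u _; apply: adde_ge0; exact: g0.
- by move=> u _; rewrite lee_fin mulr_ge0.
rewrite ge0_integralD//; first last.
- by apply/measurable_EFinP; apply: measurable_funM.
- by move=> u _; exact: g0.
- by apply/measurable_EFinP; apply: measurable_funM.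
- by move=> u _; exact: g0.
rewrite EFinD; apply: leeD.
  under eq_integral do rewrite EFinM.
  rewrite ge0_integralZl_EFin//; last first.
    by apply/measurable_EFinP.
  rewrite integral_indic// setIT [leRHS]EFinM; apply: lee_wpmul2l; first by rewrite lee_fin.
  by rewrite -lebesgue_row_cube.
rewrite (_ : 2 * C * _ = expR (- (r * A)) * C + expR (- (r * A)) * C); last by ring.
rewrite EFinD; apply: leeD; under eq_integral do rewrite EFinM;
  (rewrite ge0_integralZl_EFin ?expR_ge0//; [
   by rewrite EFinM lee_wpmul2l ?lee_fin ?expR_ge0|
   by move=> u _; rewrite lee_fin mulr_ge0 ?expR_ge0|
   by apply/measurable_EFinP]).
Qed.

End density_difference.

(** * From densities to total variation *)

Section total_variation.
Context {R : realType} {d : nat} {d1 d2 : measure_display}.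
Context {T1 : measurableType d1} {T2 : measurableType d2}.
Context (P1 : probability T1 R) (P2 : probability T2 R).
Context (X1 : {RV P1 >-> 'rV[R]_d}) (X2 : {RV P2 >-> 'rV[R]_d}).
Context (f1 f2 : 'rV[R]_d -> R) (dens1 : is_density X1 f1) (dens2 : is_density X2 f2).

(** The shifted test function 1 + g takes values in [0, 2], so inequalities between measures can be
    integrated against it; both laws have mass 1, and the shift cancels in the comparison of
    means. *)
Lemma integral_distribution_add1 {disp} {T : measurableType disp} (P : probability T R)
    (X : {RV P >-> 'rV[R]_d}) (g : 'rV[R]_d -> R) : tv_class g ->
  (\int[distribution P X]_x (1 + g x)%:E = 1 + 'E_P[g \o X])%E.
Proof.
move=> [mg g1].
rewrite ge0_integral_distribution; first last.
- by move=> x; rewrite lee_fin -lerBlDl sub0r; have := g1 x; rewrite ler_norml => /andP[].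
- by apply/measurable_EFinP; exact: measurable_funD.
have ig : P.-integrable setT (EFin \o (g \o X)).
  apply: (@integrable_bounded _ _ _ _ _ 1) => [|w]; last exact: g1.
  exact: measurableT_comp mg (measurable_rv X).
rewrite unlock /=; under eq_integral do rewrite EFinD.
rewrite integralD//; last exact: finite_measure_integrable_cst.
congr (_ + _)%E; rewrite -[RHS](@probability_setT _ _ _ P).
by rewrite integral_cst// mul1e.
Qed.

Lemma mean_fin_num {disp} {T : measurableType disp} (P : probability T R)
    (X : {RV P >-> 'rV[R]_d}) (g : 'rV[R]_d -> R) : tv_class g ->
  ('E_P[g \o X] \is a fin_num)%E.
Proof.
move=> [mg g1]; rewrite unlock; apply: integrable_fin_num => //.
apply: (@integrable_bounded _ _ _ _ _ 1) => [|w]; last exact: g1.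
exact: measurableT_comp mg (measurable_rv X).
Qed.

(* On the cube the first law is at most the second plus S times Lebesgue measure;
   outside it only the tail of the first law matters. *)
Lemma mean_le_of_density (S : R) (c : R) (A : R) (g : 'rV[R]_d -> R) :
  0 <= S -> (forall x, f1 x <= f2 x + S) -> 0 <= A ->
  (distribution P1 X1 (~` cube A) <= c%:E)%E -> tv_class g ->
  ('E_P1[g \o X1] <= 'E_P2[g \o X2] + (2 * S * (2 * A) ^+ d + 2 * c)%:E)%E.
Proof.
move=> S0 f12 A0 tail tg; have [mg g1] := tg.
have [mf1 f10 E1] := dens1; have [mf2 f20 E2] := dens2.
have mQ := @measurable_cube R d A.
have h0 x : (0 <= (1 + g x)%:E)%E.
  by rewrite lee_fin -lerBlDl sub0r; have := g1 x; rewrite ler_norml => /andP[].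
have h2 x : ((1 + g x)%:E <= cst 2%:E x)%E.
  by rewrite lee_fin; have := g1 x; rewrite ler_norml => /andP[_]; lra.
have mh : measurable_fun setT (fun x => (1 + g x)%:E).
  by apply/measurable_EFinP; exact: measurable_funD.
pose nS : {nonneg R} := NngNum S0.
(* This domination of measures holds on every measurable set, but is integrated only over the cube,
   where Lebesgue measure is finite. *)
have le12 B : measurable B -> (distribution P1 X1 B <=
    measure_add (distribution P2 X2) (mscale nS (lebesgue_row d)) B)%E.
  move=> mB.
  have -> : measure_add (distribution P2 X2) (mscale nS (lebesgue_row d)) B =
      (\int[lebesgue_row d]_(x in B) (f2 x)%:E +
       \int[lebesgue_row d]_(x in B) cst S%:E x)%E.
    by rewrite measure_addE; congr (_ + _)%E; [exact: E2|rewrite integral_cst].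
  rewrite E1// -ge0_integralD//; first last.
  - by apply/measurable_funTS/measurable_EFinP.
  - by move=> x _; rewrite lee_fin.
  apply: ge0_le_integral => //.
  - by move=> x _; rewrite lee_fin.
  - by apply/measurable_funTS/measurable_EFinP.
  - by apply: emeasurable_funD => //; apply/measurable_funTS/measurable_EFinP.
  - by move=> x _; rewrite -EFinD lee_fin.
have key : (\int[distribution P1 X1]_x (1 + g x)%:E <=
    \int[distribution P2 X2]_x (1 + g x)%:E + (2 * S * (2 * A) ^+ d + 2 * c)%:E)%E.
  rewrite -[in leLHS](setUv (cube A)) ge0_integral_setU//; first last.
  - by apply/disj_set2P; rewrite setICr.
  - exact: measurable_funTS.
  - exact: measurableC.
  rewrite [in leRHS]EFinD [leRHS]addeA; apply: leeD.
    have leQ := ge0_le_measure_integral le12 mQ h0 mh.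
    apply: (le_trans leQ).
    rewrite ge0_integral_measure_add//; last exact: measurable_funTS.
    apply: leeD; first exact: ge0_subset_integral.
    rewrite ge0_integral_mscale//; last exact: measurable_funTS.
    rewrite [2 * S]mulrC -mulrA [leRHS]EFinM; apply: lee_wpmul2l; first by rewrite lee_fin.
    apply: (@le_trans _ _ (\int[lebesgue_row d]_(x in cube A) cst 2%:E x)%E).
      apply: ge0_le_integral => //; exact: measurable_funTS.
    by rewrite integral_cst// [leRHS]EFinM -lebesgue_row_cube.
  apply: (@le_trans _ _ (\int[distribution P1 X1]_(x in ~` cube A) cst 2%:E x)%E).
    apply: ge0_le_integral => //; [exact: measurableC|exact: measurable_funTS].
  rewrite integral_cst; last exact: measurableC.
  by rewrite [leRHS]EFinM; apply: lee_wpmul2l.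
move: key; rewrite !integral_distribution_add1// -addeA leeD2lE//.
Qed.

End total_variation.

Lemma mean_diff_le {R : realType} {d : nat} {d1 d2 : measure_display}
    {T1 : measurableType d1} {T2 : measurableType d2}
    (P1 : probability T1 R) (P2 : probability T2 R)
    (X1 : {RV P1 >-> 'rV[R]_d}) (X2 : {RV P2 >-> 'rV[R]_d}) f1 f2 (S c A : R) :
  is_density X1 f1 -> is_density X2 f2 ->
  (forall x, `|f1 x - f2 x| <= S) -> 0 <= A ->
  (distribution P1 X1 (~` cube A) <= c%:E)%E ->
  (distribution P2 X2 (~` cube A) <= c%:E)%E ->
  (dTV X1 X2 <= (2 * S * (2 * A) ^+ d + 2 * c)%:E)%E.
Proof.
move=> D1 D2 fS A0 t1 t2; apply: ub_ereal_sup => _ [g tg <-].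
have S0 : 0 <= S by exact: le_trans (fS 0).
have l1 : forall x, f1 x <= f2 x + S.
  by move=> x; have := fS x; rewrite ler_norml => /andP[_]; lra.
have l2 : forall x, f2 x <= f1 x + S.
  by move=> x; have := fS x; rewrite ler_norml => /andP[+ _]; lra.
have e1 := mean_le_of_density D1 D2 S0 l1 A0 t1 tg.
have e2 := mean_le_of_density D2 D1 S0 l2 A0 t2 tg.
move: e1 e2; rewrite -(fineK (mean_fin_num X1 tg)) -(fineK (mean_fin_num X2 tg)).
rewrite -!EFinD !lee_fin => e1 e2; rewrite ler_norml; apply/andP; split; lra.
Qed.

(** * Choice of the cutoff *)

Section cutoff.
Context {R : realType} (d : nat) (d_gt0 : (0 < d)%N) (r C delta : R).
Context (r0 : 0 < r) (C0 : 0 < C) (delta0 : 0 < delta).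

(** Here L stands for - ln eps and L / r for the cutoff. As 1 <= L / L0, each lower power of L is
    absorbed into L^(d+1) at the price of powers of L0^-1. *)
Let log_bound_small (L0 L eps : R) : 0 < L0 -> L0 <= L -> 0 <= eps ->
  (1 + d%:R * (L / r)) * eps * (2 * (L / r)) ^+ d + 2 * C * eps <=
  ((L0^-1 + d%:R / r) * (2 / r) ^+ d + 2 * C / L0 ^+ (d + 1)) * (eps * L ^+ (d + 1)).
Proof.
move=> L00 LL eps0; have L_gt0 : 0 < L by exact: lt_le_trans LL.
have L1 : 1 <= L / L0 by rewrite ler_pdivlMr// mul1r.
have L1n n : 1 <= L ^+ n / L0 ^+ n by rewrite -expr_div_n exprn_ege1.
rewrite [leRHS]mulrDl; apply: lerD.
  rewrite [2 * _]mulrCA exprMn mulrAC [leRHS](_ : _ =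
    (L / L0 + d%:R * (L / r)) * (L ^+ d * (2 / r) ^+ d) * eps).
    rewrite ler_wpM2r// ler_wpM2r ?lerD2r// mulr_ge0 ?exprn_ge0 ?divr_ge0 ?ltW//.
  by rewrite exprD expr1; ring.
rewrite [leRHS](_ : _ = 2 * C * eps * (L ^+ (d + 1) / L0 ^+ (d + 1))); last by ring.
by rewrite ler_peMr// !mulr_ge0// ltW.
Qed.

(** Below 1, A = - ln eps / r turns e^{-rA} into eps, so both terms of [density_bound] have order
    eps |ln eps|^(d+1); the volume (2A)^d of the cube brings d more logarithms for the total
    variation. Above 1 + delta, the bounds at A = 0 are constants, absorbed because eps >= 1 and |ln
    eps| >= ln(1 + delta). *)
Lemma cutoff_exists : exists G G' : R, [/\ 0 < G, 0 < G' &
  forall eps, 0 < eps <= 1 - delta \/ 1 + delta <= eps ->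
  exists A, [/\ 0 <= A, @density_bound R d r C eps A <= G' * (eps * `|ln eps| ^+ (d + 1)) &
    2 * @density_bound R d r C eps A * (2 * A) ^+ d + 2 * (C * expR (- (r * A))) <=
    G * (eps * `|ln eps| ^+ (2 * d + 1))]].
Proof.
pose c : R := (2 * pi) ^- d.
have c0 : 0 < c by rewrite invr_gt0 exprn_gt0// mulr_gt0// pi_gt0.
(* For delta >= 1 no eps lies in the lower range; [ln] then takes its default value 0 and so does
   [L0^-1], which leaves the constants nonnegative. Their positivity comes from the terms with
   [L1]. *)
pose L0 : R := - ln (1 - delta); pose L1 : R := ln (1 + delta).
have L00 : 0 <= L0 by rewrite oppr_ge0 ln_le0// lerBlDr lerDl ltW.
have L10 : 0 < L1 by rewrite ln_gt0// ltrDl.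
pose K := (L0^-1 + d%:R / r) * (2 / r) ^+ d + 2 * C / L0 ^+ (d + 1).
have rd0 : 0 <= (2 / r) ^+ d by rewrite exprn_ge0// divr_ge0// ltW.
have K0 : 0 <= K.
  by rewrite addr_ge0// ?mulr_ge0// ?addr_ge0 ?invr_ge0 ?exprn_ge0 ?mulr_ge0 ?invr_ge0// ltW.
have C1 n : 0 < 2 * C / L1 ^+ n by rewrite divr_gt0 ?mulr_gt0 ?exprn_gt0.
have C2 n : 0 <= 2 * C / L0 ^+ n by rewrite divr_ge0 ?mulr_ge0 ?exprn_ge0 ?(ltW C0).
exists (2 * c * K * (2 / r) ^+ d + 2 * C / L0 ^+ (2 * d + 1) + 2 * C / L1 ^+ (2 * d + 1)).
exists (c * (K + 2 * C / L1 ^+ (d + 1))); split.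
- by rewrite ltr_wpDl// addr_ge0// !mulr_ge0// ltW.
- by rewrite mulr_gt0// ltr_wpDl.
move=> eps [/andP[eps0 epsd]|epsd].
  have d1 : 0 < 1 - delta by exact: lt_le_trans epsd.
  have LL : L0 <= - ln eps by rewrite lerN2 ler_ln.
  have L0_gt0 : 0 < L0 by rewrite oppr_gt0 ln_lt0// d1 ltrBlDr ltrDl.
  have L_gt0 : 0 < - ln eps by exact: lt_le_trans LL.
  have nE : `|ln eps| = - ln eps by rewrite ltr0_norm// -oppr_gt0.
  exists (- ln eps / r).
  have eE : expR (- (r * (- ln eps / r))) = eps.
    by rewrite mulrCA divff ?gt_eqF// mulr1 opprK lnK.
  rewrite /density_bound eE nE; set L := - ln eps in LL L_gt0 *.
  have B := log_bound_small L0_gt0 LL (ltW eps0).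
  have eL n : 0 <= eps * L ^+ n by rewrite mulr_ge0 ?exprn_ge0 ?(ltW eps0) ?(ltW L_gt0).
  split; first by rewrite divr_ge0// ltW.
    rewrite -[leRHS]mulrA ler_wpM2l ?(ltW c0)// (le_trans B)// ler_wpM2r//.
    by rewrite lerDl ltW.
  rewrite [leRHS]mulrDl -[leLHS]addr0; apply: lerD; last by rewrite mulr_ge0// ltW.
  rewrite [leRHS]mulrDl; apply: lerD.
    apply: (@le_trans _ _ (2 * (c * (K * (eps * L ^+ (d + 1)))) * (2 * (L / r)) ^+ d)).
      rewrite ler_wpM2r ?exprn_ge0 ?mulr_ge0 ?invr_ge0 ?(ltW L_gt0) ?(ltW r0)//.
      by rewrite ler_wpM2l// ler_wpM2l ?(ltW c0).
    rewrite le_eqVlt; apply/orP; left; apply/eqP.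
    have -> : (2 * (L / r)) ^+ d = L ^+ d * (2 / r) ^+ d by rewrite mulrCA exprMn.
    have -> : L ^+ (2 * d + 1) = L ^+ d * L ^+ (d + 1).
      by rewrite -exprD addnA addnn mul2n.
    by move: (L ^+ d) (L ^+ (d + 1)) ((2 / r) ^+ d) => x1 x2 x3; ring.
  have L1n n : 1 <= L ^+ n / L0 ^+ n by rewrite -expr_div_n exprn_ege1// ler_pdivlMr// mul1r.
  rewrite [leRHS](_ : _ = 2 * (C * eps) * (L ^+ (2 * d + 1) / L0 ^+ (2 * d + 1))); last by ring.
  by rewrite ler_peMr// !mulr_ge0// ltW.
have eps1 : 1 <= eps by rewrite (le_trans _ epsd)// lerDl ltW.
have LL : L1 <= `|ln eps|.
  rewrite (le_trans _ (ler_norm _))// ler_ln// posrE ?(lt_le_trans ltr01 eps1)//.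
  by rewrite ltr_wpDl ?ler01.
have big n : 2 * C <= 2 * C / L1 ^+ n * (eps * `|ln eps| ^+ n).
  rewrite [leRHS](_ : _ = 2 * C * (eps * (`|ln eps| / L1) ^+ n)); last first.
    by rewrite expr_div_n; ring.
  rewrite ler_peMr ?mulr_ge0 ?(ltW C0)// mulr_ege1// exprn_ege1//.
  by rewrite ler_pdivlMr// mul1r.
have eL n : 0 <= eps * `|ln eps| ^+ n by rewrite mulr_ge0 ?exprn_ge0// (le_trans _ eps1).
(* With A = 0 and d > 0 the cube has volume 0: every term with a factor (2A)^d disappears. *)
exists 0; rewrite /density_bound !mulr0 oppr0 expR0 !mulr1 expr0n.
rewrite (gtn_eqF d_gt0) !mulr0 !add0r.
split => //.
  by rewrite -[leRHS]mulrA ler_wpM2l ?(ltW c0)// (le_trans (big (d + 1)%N))// ler_wpM2r// lerDr.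
rewrite (le_trans (big (2 * d + 1)%N))// ler_wpM2r// lerDr addr_ge0//.
by rewrite !mulr_ge0// ltW.
Qed.

(** Serves the case d_FM = 0, where only the tail terms remain and A is arbitrary. *)
Lemma exp_cutoff_le0 (x k : R) :
  (forall A, 0 <= A -> x <= k * expR (- (r * A))) -> x <= 0.
Proof.
move=> h; have c : k * expR (- (r * A)) @[A --> +oo] --> k * 0.
  by apply: cvgMr; exact: cvg_expRNM.
rewrite mulr0 in c; apply: (cvgr_to_ge c).
by near=> A; apply: h; near: A; exact: nbhs_pinfty_ge.
Unshelve. all: by end_near. Qed.

End cutoff.

Unset Implicit Arguments.

Theorem lemma6p1 (R : realType) (d : nat) (hd : (1 <= d)%N)
    (r Cr : R) (hr : 0 < r) (hCr : 0 < Cr) (delta : R) (hdelta : 0 < delta) :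
  exists G G' : R,
  forall (disp1 disp2 : measure_display)
    (T1 : measurableType disp1) (T2 : measurableType disp2)
    (P1 : probability T1 R) (P2 : probability T2 R)
    (X1 : {RV P1 >-> 'rV[R]_d}) (X2 : {RV P2 >-> 'rV[R]_d}),
  ('E_P1[fun w => expR (r * enorm (X1 w))] <= Cr%:E)%E ->
  ('E_P2[fun w => expR (r * enorm (X2 w))] <= Cr%:E)%E ->
  (\int[lebesgue_row d]_u
     (ComplexField.Normc.normc (charfun X1 u) * expR (r * enorm u))%:E
     <= Cr%:E)%E ->
  (\int[lebesgue_row d]_u
     (ComplexField.Normc.normc (charfun X2 u) * expR (r * enorm u))%:E
     <= Cr%:E)%E ->
  (delta%:E <= `|dFM X1 X2 - 1|)%E ->
  (dTV X1 X2 <= G%:E * (dFM X1 X2 * `|lne (dFM X1 X2)| ^+ (2 * d + 1)))%E /\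
  exists f1 f2 : 'rV[R]_d -> R,
    [/\ is_density X1 f1, is_density X2 f2,
        forall x, (f1 x)%:C%C = inverse_fourier (charfun X1) x,
        forall x, (f2 x)%:C%C = inverse_fourier (charfun X2) x &
        (ereal_sup (range (fun x => `|f1 x - f2 x|%:E))
          <= G'%:E * (dFM X1 X2 * `|lne (dFM X1 X2)| ^+ (d + 1)))%E].
Proof.
(* The choice of constants concerns real numbers only, so [G] and [G'] are fixed before any law is
   introduced. *)
have [G [G' [G0 G'0 cut]]] := cutoff_exists hd hr hCr hdelta.
exists G, G'; move=> disp1 disp2 T1 T2 P1 P2 X1 X2 m1 m2 p1 p2 away.
have i1 := integrable_charfun hr p1; have i2 := integrable_charfun hr p2.
have D1 := is_density_inv_phase i1; have D2 := is_density_inv_phase i2.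
suff : (dTV X1 X2 <= G%:E * (dFM X1 X2 * `|lne (dFM X1 X2)| ^+ (2 * d + 1)))%E /\
    forall x, (`|inv_phase X1 x 0 - inv_phase X2 x 0|%:E <=
      G'%:E * (dFM X1 X2 * `|lne (dFM X1 X2)| ^+ (d + 1)))%E.
  move=> [tv dens]; split => //; exists (inv_phase X1 ^~ 0), (inv_phase X2 ^~ 0).
  split => //; [exact: inverse_fourierE..|].
  by apply: ub_ereal_sup => _ [x _ <-]; exact: dens.
have eps_ge0 := dFM_ge0 X1 X2.
(* For the case [dFM] = +oo, where both right-hand sides are +oo; the exponents 2d+1 and d+1 are
   successors. *)
have y_exp n : ((+oo : \bar R) ^+ n.+1 = +oo)%E.
  by elim: n => [|n IH]; rewrite ?expe1// expeS IH.
case dE : (dFM X1 X2) => [eps| |]; last by move: eps_ge0; rewrite dE.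
  have tails A := (tail_probability A hr m1, tail_probability A hr m2).
  have dens A z (A0 : 0 <= A) := density_diff_le hr p1 p2 dE z A0.
  have tv A S (A0 : 0 <= A) h := mean_diff_le D1 D2 h A0 (tails A).1 (tails A).2 (S := S).
  have [eps0|eps0] := leP eps 0.
    have eps_eq0 : eps = 0.
      by apply/eqP; rewrite eq_le eps0 -lee_fin -dE eps_ge0.
    (* The right-hand sides become 0 because 0 * +oo = 0, so the densities and the laws have to
       coincide exactly. *)
    rewrite eps_eq0 !mul0e !mule0.
    have eqf z : `|inv_phase X1 z 0 - inv_phase X2 z 0| <= 0.
      apply: (exp_cutoff_le0 hr (k := (2 * pi) ^- d * (2 * Cr))) => A A0.
      apply: (le_trans (dens A z A0)).
      by rewrite /density_bound eps_eq0 mulr0 mul0r add0r mulrA.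
    split; last by move=> x; rewrite lee_fin.
    have tv0 A : 0 <= A -> (dTV X1 X2 <= (2 * Cr * expR (- (r * A)))%:E)%E.
      move=> A0; have := tv A 0 A0 eqf.
      by rewrite mulr0 mul0r add0r mulrA.
    (* The limit in A is taken in R. Finiteness follows from the bound at A = 0 and, from below,
       from the zero test function. *)
    have tvfin : dTV X1 X2 \is a fin_num.
      rewrite ge0_fin_numE; first exact: le_lt_trans (tv0 0 (lexx _)) (ltry _).
      have t0 : tv_class (fun _ : 'rV[R]_d => 0 : R) by split => // x; rewrite normr0.
      by apply: le_trans (ereal_sup_ubound _); last by exists (fun=> 0); [exact: t0|].
    rewrite -(fineK tvfin) lee_fin; apply: (exp_cutoff_le0 hr (k := 2 * Cr)) => A A0.
    by rewrite -lee_fin fineK//; exact: tv0.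
  have eps_range : 0 < eps <= 1 - delta \/ 1 + delta <= eps.
    move: away; rewrite dE -EFinB abse_EFin lee_fin eps0/= => away.
    have [e1|e1] := leP 1 eps.
      by right; move: away; rewrite ger0_norm ?subr_ge0//; lra.
    by left; move: away; rewrite ltr0_norm ?subr_lt0//; lra.
  have [A [A0 B1 B2]] := cut eps eps_range.
  rewrite lne_EFin// abse_EFin -!EFin_expe -!EFinM; split.
    apply: le_trans (tv A _ A0 (fun x => dens A x A0)) _.
    by rewrite lee_fin.
  by move=> x; rewrite lee_fin (le_trans (dens A x A0)).
rewrite /= !addn1 !y_exp; split; first by rewrite mulyy gt0_muley ?leey// lte_fin.
by move=> x; rewrite mulyy gt0_muley ?leey// lte_fin.
Qed.
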